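(* Let $A\subseteq 2^\omega$ be a Lebesgue null set that is closed under hyperarithmetic equivalence $\equiv_h$ and contains no hyperarithmetic real. Then the set $\mathcal{U}_h(A)=\{x\in 2^\omega:\exists y\in A\ (x\ge_h y)\}$ is null.
   Context: $x\ge_h y$ means $y$ is hyperarithmetic in $x$ (i.e. $y\in\Delta^1_1(x)$); $\equiv_h$ is the induced equivalence. A set of reals closed under $\equiv_h$ is identified with a set of hyperdegrees; ''contains no hyperarithmetic real'' means it does not contain the least hyperdegree $\mathbf{0}$. Null means Lebesgue (outer) measure zero. *)

(* Defs.v *)
(* Cantor space, Lebesgue null sets, and hyperarithmetic
   reducibility (via Kleene's characterization Delta^1_1(x)). *)
From Stdlib Require Import Reals List Arith.
Open Scope R_scope.

Definition real := nat -> bool.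

Definition extends (x : real) (s : list bool) : Prop :=
  forall i, (i < length s)%nat -> nth i s false = x i.

Definition null (A : real -> Prop) : Prop :=
  forall eps : R, 0 < eps ->
    exists c : nat -> list bool,
      (forall N : nat, sum_f_R0 (fun k => (/ 2) ^ length (c k)) N <= eps) /\
      (forall x, A x -> exists k, extends x (c k)).

(** Arithmetic formulas of second-order arithmetic with one set parameter
    X (the oracle) and one set variable Y; number variables are de Bruijn
    indices. *)
Inductive term : Type :=
| tvar : nat -> term
| tzero : term
| tsucc : term -> term
| tplus : term -> term -> term
| tmult : term -> term -> term.

Inductive formula : Type :=
| feq : term -> term -> formula
| flt : term -> term -> formula
| fmemX : term -> formula
| fmemY : term -> formula
| fneg : formula -> formula
| fand : formula -> formula -> formula
| for_ : formula -> formula -> formula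
| fex : formula -> formula
| fall : formula -> formula.

Fixpoint teval (env : nat -> nat) (t : term) : nat :=
  match t with
  | tvar i => env i
  | tzero => 0%nat
  | tsucc t => S (teval env t)
  | tplus a b => (teval env a + teval env b)%nat
  | tmult a b => (teval env a * teval env b)%nat
  end.

Definition scons (n : nat) (env : nat -> nat) : nat -> nat :=
  fun i => match i with O => n | S j => env j end.

Fixpoint sat (X Y : real) (env : nat -> nat) (f : formula) : Prop :=
  match f with
  | feq a b => teval env a = teval env b
  | flt a b => (teval env a < teval env b)%nat
  | fmemX a => X (teval env a) = true
  | fmemY a => Y (teval env a) = true
  | fneg g => ~ sat X Y env g
  | fand g h => sat X Y env g /\ sat X Y env h
  | for_ g h => sat X Y env g \/ sat X Y env h
  | fex g => exists n, sat X Y (scons n env) g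
  | fall g => forall n, sat X Y (scons n env) g
  end.

Definition Sigma11 (x : real) (S : nat -> Prop) : Prop :=
  exists phi : formula,
    forall n, S n <-> exists Y : real, sat x Y (scons n (fun _ => 0%nat)) phi.

Definition Delta11 (x : real) (S : nat -> Prop) : Prop :=
  Sigma11 x S /\ Sigma11 x (fun n => ~ S n).

Definition hyp_le (y x : real) : Prop := Delta11 x (fun n => y n = true).

Definition hyp_equiv (x y : real) : Prop := hyp_le x y /\ hyp_le y x.

Definition hyperarithmetic (y : real) : Prop := hyp_le y (fun _ => false).

Definition upward_h (A : real -> Prop) : real -> Prop :=
  fun x => exists y, A y /\ hyp_le y x.

(* Main.v *)
(* Every [Sigma11] predicate is put in the form [U x m]: a countable system of binary constraints, each reading one bit of [x], has a solution [w : nat -> nat]. Sets [{x | U x m}] are inner regular for the compact sets of the [x] with a solution below a fixed bound, so that "[{x | U x m}] has measure > r" is again [Sigma11].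

   Let [W] be the diagonal lightface Pi11 set of [m] whose tree of attempts at a solution is well-founded. By Lebesgue density and the previous remark, [W] is [Sigma11] in [x] only for a null set of [x]. For the other [x], if [y] is [Delta11] in [x] then the trees refuting [y n = false] are bounded in rank by a single tree with index [m] in [W]; comparing ranks with this tree gives [y = f x] for a total [Delta11] map [f], one of countably many.

   For such an [f], the image [nu] of Lebesgue measure has a hyperarithmetic distribution function [vl]. Atoms of [nu] are hyperarithmetic, hence not in [A]. Outside a null set the other values [y = f x] are hyperarithmetically equivalent to the binary expansion [G y] of [vl y], which is then in [A]; as [vl] maps the continuous part of [nu] to Lebesgue measure, [f x] is in [A] for almost no [x]. *)

Require Import Defs.
From Stdlib Require Import Reals List Arith ZArith Lia Lra.
From Stdlib Require Import Classical ClassicalEpsilon FunctionalExtensionality PropExtensionality.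
Local Open Scope nat_scope.

(** * Pairing *)

(** A Delta11 definition of [y] from one [x] cannot be used as it stands: its two indices need not
    be complementary at other oracles. Bounding ranks replaces it by one of countably many total
    maps [f], and it remains to show that each preimage of [A] is null. For null sets in general
    this fails, as [nu] may be singular or have atoms. Closure under hyperarithmetic equivalence is
    what allows [y] to be exchanged for [G y], whose distribution off the atoms is bounded by
    Lebesgue measure.

    The exceptional null set comes from a majority vote. If one index defined [W] from [x] for a set
    of [x] of positive outer measure, it would do so on more than 3/4 of some cylinder, and [m]
    would be in [W] exactly when more than half of the cylinder says so: a lightface Sigma11
    definition of [W], which diagonalization excludes.

    The preimages of [A] are not known to be measurable in advance, so [mu] is an outer measure;
    measurability is established for the sets [{x | U x m}]. *)

Definition pair (a b : nat) : nat := (a + b) * (a + b) + a.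
Definition p1 (m : nat) : nat := m - Nat.sqrt m * Nat.sqrt m.
Definition p2 (m : nat) : nat := Nat.sqrt m - p1 m.

(** The summand [a] is too small to reach the next square. Being a polynomial, [pair] is itself a
    term of the language of arithmetic ([tpair]). *)
Lemma sqrt_pair a b : Nat.sqrt (pair a b) = a + b.
Proof. apply Nat.sqrt_unique; unfold pair; nia. Qed.

Lemma p1_pair a b : p1 (pair a b) = a.
Proof. unfold p1; rewrite sqrt_pair; unfold pair; lia. Qed.

Lemma p2_pair a b : p2 (pair a b) = b.
Proof. unfold p2; rewrite p1_pair, sqrt_pair; lia. Qed.

Lemma pair_inj a b c d : pair a b = pair c d -> a = c /\ b = d.
Proof.
  intros H; split.
  - now rewrite <- (p1_pair a b), H, p1_pair.
  - now rewrite <- (p2_pair a b), H, p2_pair.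
Qed.

Fixpoint tail_iter (i c : nat) : nat :=
  match i with O => c | S i => p2 (tail_iter i c) end.

(* A number [c] codes the environment [dec c]; since [pair 0 0 = 0], the code [0] stands for the zero environment. *)
Definition dec (c i : nat) : nat := p1 (tail_iter i c).

Lemma tail_iter_S i c : tail_iter (S i) c = tail_iter i (p2 c).
Proof. induction i; simpl in *; congruence. Qed.

Lemma dec_pair n c : dec (pair n c) = scons n (dec c).
Proof.
  apply functional_extensionality; intros [|i]; unfold dec.
  - simpl. apply p1_pair.
  - rewrite tail_iter_S, p2_pair. reflexivity.
Qed.

Lemma dec_0 : dec 0 = fun _ => 0.
Proof.
  apply functional_extensionality; intro i; unfold dec.
  assert (H : tail_iter i 0 = 0) by (induction i; simpl; [|rewrite IHi]; reflexivity).
  rewrite H; reflexivity.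
Qed.

Lemma dec_surj (w : nat -> nat) k : exists c, forall i, i < k -> dec c i = w i.
Proof.
  revert w; induction k as [|k IH]; intros w.
  - exists 0; lia.
  - destruct (IH (fun i => w (S i))) as [c Hc].
    exists (pair (w 0) c); intros [|i] Hi; rewrite dec_pair; simpl; auto.
    apply Hc; lia.
Qed.

(** * Positive second-order formulas *)

(** Without negation and with existential function quantifiers only, every formula is Sigma11 by its
    shape, wherever [SExF] occurs in it. *)
Inductive sf : Type :=
| SEq : term -> term -> sf
| SNe : term -> term -> sf
| SAp : nat -> term -> term -> sf
| SAnd : sf -> sf -> sf
| SOr : sf -> sf -> sf
| SEx : sf -> sf
| SAll : sf -> sf
| SExF : sf -> sf.

Definition fcons (F : nat -> nat) (s : nat -> nat -> nat) : nat -> nat -> nat :=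
  fun i => match i with O => F | S j => s j end.

Fixpoint ssat (s : nat -> nat -> nat) (e : nat -> nat) (f : sf) : Prop :=
  match f with
  | SEq t u => teval e t = teval e u
  | SNe t u => teval e t <> teval e u
  | SAp i t u => s i (teval e t) = teval e u
  | SAnd f g => ssat s e f /\ ssat s e g
  | SOr f g => ssat s e f \/ ssat s e g
  | SEx f => exists n, ssat s (scons n e) f
  | SAll f => forall n, ssat s (scons n e) f
  | SExF f => exists F, ssat (fcons F s) e f
  end.

Definition lift (r : nat -> nat) (i : nat) : nat :=
  match i with O => O | S j => S (r j) end.

Fixpoint tren (r : nat -> nat) (t : term) : term :=
  match t with
  | tvar i => tvar (r i)
  | tzero => tzero
  | tsucc t => tsucc (tren r t)
  | tplus t u => tplus (tren r t) (tren r u)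
  | tmult t u => tmult (tren r t) (tren r u)
  end.

Lemma teval_tren r e t : teval e (tren r t) = teval (fun i => e (r i)) t.
Proof. induction t; simpl; congruence. Qed.

Fixpoint sren (rf r : nat -> nat) (f : sf) : sf :=
  match f with
  | SEq t u => SEq (tren r t) (tren r u)
  | SNe t u => SNe (tren r t) (tren r u)
  | SAp i t u => SAp (rf i) (tren r t) (tren r u)
  | SAnd f g => SAnd (sren rf r f) (sren rf r g)
  | SOr f g => SOr (sren rf r f) (sren rf r g)
  | SEx f => SEx (sren rf (lift r) f)
  | SAll f => SAll (sren rf (lift r) f)
  | SExF f => SExF (sren (lift rf) r f)
  end.

Lemma scons_lift n e r :
  (fun i => scons n e (lift r i)) = scons n (fun i => e (r i)).
Proof. apply functional_extensionality; intros [|i]; reflexivity. Qed.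

Lemma fcons_lift F s r :
  (fun i => fcons F s (lift r i)) = fcons F (fun i => s (r i)).
Proof. apply functional_extensionality; intros [|i]; reflexivity. Qed.

Lemma ssat_sren f : forall rf r s e,
  ssat s e (sren rf r f) <-> ssat (fun i => s (rf i)) (fun i => e (r i)) f.
Proof.
  induction f; intros rf r s e; simpl; rewrite ?teval_tren; try tauto.
  - rewrite IHf1, IHf2; tauto.
  - rewrite IHf1, IHf2; tauto.
  - split; intros [n H]; exists n; [rewrite IHf, scons_lift in H | rewrite IHf, scons_lift]; exact H.
  - split; intros H n; specialize (H n); [rewrite IHf, scons_lift in H | rewrite IHf, scons_lift]; exact H.
  - split; intros [n H]; exists n; [rewrite IHf, fcons_lift in H | rewrite IHf, fcons_lift]; exact H.
Qed.

(** * Definable predicates and functions *)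

Record ctx := Ctx { fv : nat -> nat -> nat; nv : nat -> nat }.

Definition hd (g : ctx) : nat := nv g 0.
Definition tl (g : ctx) : ctx := Ctx (fv g) (fun i => nv g (S i)).
Definition hdF (g : ctx) : nat -> nat := fv g 0.
Definition tlF (g : ctx) : ctx := Ctx (fun i => fv g (S i)) (nv g).

(** Definability of a predicate given semantically: Sigma11 uniformly in all function and number
    variables. Closure properties then replace the writing of formulas. *)
Definition Sg (P : ctx -> Prop) : Prop :=
  exists f, forall g, P g <-> ssat (fv g) (nv g) f.

Definition CM (r : ctx -> ctx) : Prop :=
  exists rf rn, forall g, r g = Ctx (fun i => fv g (rf i)) (fun i => nv g (rn i)).

(** Only the graph is asked to be Sigma11. As [t] is total, this serves negative atoms as well:
    [t g <> u g] holds when the values found through the two graphs differ. *)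
Definition Fn (t : ctx -> nat) : Prop := Sg (fun g => t (tl g) = hd g).
Definition FnF (F : ctx -> nat -> nat) : Prop := Fn (fun g => F (tl g) (hd g)).

Lemma cm_id : CM (fun g => g).
Proof. exists (fun i => i), (fun i => i); intros []; reflexivity. Qed.

Lemma cm_tl r : CM r -> CM (fun g => tl (r g)).
Proof.
  intros (rf & rn & H). exists rf, (fun i => rn (S i)); intro g; rewrite H; reflexivity.
Qed.

Lemma cm_tlF r : CM r -> CM (fun g => tlF (r g)).
Proof.
  intros (rf & rn & H). exists (fun i => rf (S i)), rn; intro g; rewrite H; reflexivity.
Qed.

Lemma sg_ext P Q : (forall g, P g <-> Q g) -> Sg P -> Sg Q.
Proof. intros H [f Hf]; exists f; intro g; rewrite <- H; apply Hf. Qed.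

Lemma sg_ren P r : Sg P -> CM r -> Sg (fun g => P (r g)).
Proof.
  intros [f Hf] (rf & rn & Hr). exists (sren rf rn f); intro g.
  rewrite ssat_sren, Hf, Hr; reflexivity.
Qed.

Lemma sg_and P Q : Sg P -> Sg Q -> Sg (fun g => P g /\ Q g).
Proof. intros [f Hf] [h Hh]; exists (SAnd f h); intro g; simpl; rewrite Hf, Hh; tauto. Qed.

Lemma sg_or P Q : Sg P -> Sg Q -> Sg (fun g => P g \/ Q g).
Proof. intros [f Hf] [h Hh]; exists (SOr f h); intro g; simpl; rewrite Hf, Hh; tauto. Qed.

Lemma sg_ex (P : ctx -> nat -> Prop) :
  Sg (fun g => P (tl g) (hd g)) -> Sg (fun g => exists n, P g n).
Proof.
  intros [f Hf]; exists (SEx f); intros [s e]; simpl.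
  split; intros [n H]; exists n; apply (Hf (Ctx s (scons n e))), H.
Qed.

Lemma sg_all (P : ctx -> nat -> Prop) :
  Sg (fun g => P (tl g) (hd g)) -> Sg (fun g => forall n, P g n).
Proof.
  intros [f Hf]; exists (SAll f); intros [s e]; simpl.
  split; intros H n; apply (Hf (Ctx s (scons n e))), H.
Qed.

Lemma sg_exF (P : ctx -> (nat -> nat) -> Prop) :
  Sg (fun g => P (tlF g) (hdF g)) -> Sg (fun g => exists F : nat -> nat, P g F).
Proof.
  intros [f Hf]; exists (SExF f); intros [s e]; simpl.
  split; intros [F H]; exists F; apply (Hf (Ctx (fcons F s) e)), H.
Qed.

Lemma fn_ren t r : Fn t -> CM r -> Fn (fun g => t (r g)).
Proof.
  intros Ht (rf & rn & Hr). unfold Fn in *.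
  apply (sg_ren _ (fun g => Ctx (fun i => fv g (rf i)) (fun i => nv g (lift rn i)))) in Ht.
  2: { exists rf, (lift rn); reflexivity. }
  revert Ht; apply sg_ext; intro g. rewrite Hr. reflexivity.
Qed.

Lemma fnF_ren F r : FnF F -> CM r -> FnF (fun g => F (r g)).
Proof.
  intros HF (rf & rn & Hr). unfold FnF in *.
  apply (fn_ren _ (fun g => Ctx (fun i => fv g (rf i)) (fun i => nv g (lift rn i)))) in HF.
  2: { exists rf, (lift rn); reflexivity. }
  revert HF; apply sg_ext; intro g. rewrite Hr. reflexivity.
Qed.

Lemma fn_hd r : CM r -> Fn (fun g => hd (r g)).
Proof.
  intros (rf & rn & Hr). exists (SEq (tvar (S (rn 0))) (tvar 0)); intro g.
  rewrite Hr; simpl; reflexivity.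
Qed.

Lemma fn_app F t : FnF F -> Fn t -> Fn (fun g => F g (t g)).
Proof.
  intros HF Ht. unfold Fn.
  apply (sg_ext (fun g => exists v, t (tl g) = v /\ F (tl g) v = hd g)).
  { intro g; split; [intros (v & <- & H) | intro H; exists (t (tl g))]; auto. }
  (* Variable 0 is now the intermediate value, 1 the result, and the old variables start at 2; the
     two renamings restore the order expected by [Ht] and [HF]. *)
  apply sg_ex, sg_and.
  - apply (sg_ren _ (fun g => Ctx (fv g) (fun i => nv g (match i with O => 0 | S i => S (S i) end)))) in Ht.
    2: { exists (fun i => i), (fun i => match i with O => 0 | S i => S (S i) end); reflexivity. }
    revert Ht; apply sg_ext; intro g; reflexivity.
  - apply (sg_ren _ (fun g => Ctx (fv g) (fun i => nv g
       (match i with O => 1 | S O => 0 | S (S i) => S (S i) end)))) in HF.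
    2: { exists (fun i => i), (fun i => match i with O => 1 | S O => 0 | S (S i) => S (S i) end); reflexivity. }
    revert HF; apply sg_ext; intro g; reflexivity.
Qed.

Lemma fnF_hdF r : CM r -> FnF (fun g => hdF (r g)).
Proof.
  intros (rf & rn & Hr). exists (SAp (rf 0) (tvar 1) (tvar 0)); intro g.
  rewrite Hr; simpl; reflexivity.
Qed.

Lemma sg_eq t u : Fn t -> Fn u -> Sg (fun g => t g = u g).
Proof.
  intros Ht Hu.
  apply (sg_ext (fun g => exists v, t g = v /\ u g = v)).
  { intro g; split; [intros (v & -> & H) | intro H; exists (t g)]; auto. }
  apply sg_ex, sg_and; assumption.
Qed.

Lemma sg_bin (f : sf) (R : nat -> nat -> Prop) t u :
  (forall s e, R (e 1) (e 0) <-> ssat s e f) ->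
  Fn t -> Fn u -> Sg (fun g => R (t g) (u g)).
Proof.
  intros Hf Ht Hu.
  apply (sg_ext (fun g => exists v w, t g = v /\ u g = w /\ R v w)).
  { intro g; split; [intros (v & w & -> & -> & H) | intro H; exists (t g), (u g)]; auto. }
  apply sg_ex, sg_ex, sg_and; [|apply sg_and].
  - apply (sg_ren _ tl Ht), (cm_tl _ cm_id).
  - apply (fn_ren _ tl) in Hu; [exact Hu|apply (cm_tl _ cm_id)].
  - exists f; intro g; apply (Hf (fv g)).
Qed.

Lemma sg_ne t u : Fn t -> Fn u -> Sg (fun g => t g <> u g).
Proof. apply (sg_bin (SNe (tvar 1) (tvar 0)) (fun a b => a <> b)); reflexivity. Qed.

Lemma sg_le t u : Fn t -> Fn u -> Sg (fun g => t g <= u g).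
Proof.
  apply (sg_bin (SEx (SEq (tplus (tvar 2) (tvar 0)) (tvar 1))) (fun a b => a <= b)).
  intros s e; simpl. split; [intro H; exists (e 0 - e 1) | intros [d H]]; lia.
Qed.

Lemma sg_lt t u : Fn t -> Fn u -> Sg (fun g => t g < u g).
Proof.
  apply (sg_bin (SEx (SEq (tsucc (tplus (tvar 2) (tvar 0))) (tvar 1))) (fun a b => a < b)).
  intros s e; simpl. split; [intro H; exists (e 0 - S (e 1)) | intros [d H]]; lia.
Qed.

Lemma fn_graph (t : ctx -> nat) (Q : ctx -> nat -> Prop) :
  (forall g v, t g = v <-> Q g v) -> Sg (fun g => Q (tl g) (hd g)) -> Fn t.
Proof. intros H; apply sg_ext; intro g; symmetry; apply H. Qed.

Fixpoint numeral (n : nat) : term :=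
  match n with O => tzero | S n => tsucc (numeral n) end.

Lemma teval_numeral e n : teval e (numeral n) = n.
Proof. induction n; simpl; congruence. Qed.

Lemma fn_const c : Fn (fun _ => c).
Proof. exists (SEq (numeral c) (tvar 0)); intro g; simpl; rewrite teval_numeral; reflexivity. Qed.

Ltac cm := repeat first [apply cm_id | apply cm_tl | apply cm_tlF].

Lemma fn_succ t : Fn t -> Fn (fun g => S (t g)).
Proof.
  intros Ht. apply (fn_app (fun _ n => S n)); [|exact Ht].
  exists (SEq (tsucc (tvar 1)) (tvar 0)); reflexivity.
Qed.

Lemma fn_bin (w : term) (R : nat -> nat -> nat) t u :
  (forall e, teval e w = R (e 0) (e 1)) ->
  Fn t -> Fn u -> Fn (fun g => R (t g) (u g)).
Proof.
  intros Hw Ht Hu. apply (fn_app (fun g => R (t g))); [|exact Hu].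
  unfold FnF.
  apply (fn_app (fun g n => R n (hd g)) (fun g => t (tl g))).
  - exists (SEq (tren S w) (tvar 0)); intro g; simpl.
    rewrite teval_tren, Hw; reflexivity.
  - apply fn_ren; [exact Ht|cm].
Qed.

Lemma fn_plus t u : Fn t -> Fn u -> Fn (fun g => t g + u g).
Proof. apply (fn_bin (tplus (tvar 0) (tvar 1))); reflexivity. Qed.

Lemma fn_mult t u : Fn t -> Fn u -> Fn (fun g => t g * u g).
Proof. apply (fn_bin (tmult (tvar 0) (tvar 1))); reflexivity. Qed.

Definition FnF2 (F : ctx -> nat -> nat -> nat) : Prop :=
  Fn (fun g => F (tl (tl g)) (hd (tl g)) (hd g)).

Lemma fn_app2 F t u : FnF2 F -> Fn t -> Fn u -> Fn (fun g => F g (t g) (u g)).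
Proof.
  intros HF Ht Hu. apply (fn_app (fun g => F g (t g))); [|exact Hu].
  apply (fn_app (fun g n => F (tl g) n (hd g)) (fun g => t (tl g))).
  - unfold FnF.
    apply (fn_ren _ (fun g => Ctx (fv g) (fun i => nv g
       (match i with O => 1 | S O => 0 | S (S i) => S (S i) end)))) in HF.
    2: { exists (fun i => i), (fun i => match i with O => 1 | S O => 0 | S (S i) => S (S i) end); reflexivity. }
    revert HF; apply sg_ext; intro g; reflexivity.
  - apply fn_ren; [exact Ht|cm].
Qed.

Lemma fnF2_ren F r : FnF2 F -> CM r -> FnF2 (fun g => F (r g)).
Proof.
  intros HF (rf & rn & Hr). unfold FnF2 in *.
  apply (fn_ren _ (fun g => Ctx (fun i => fv g (rf i)) (fun i => nv g (lift (lift rn) i)))) in HF.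
  2: { exists rf, (lift (lift rn)); reflexivity. }
  revert HF; apply sg_ext; intro g. rewrite Hr. reflexivity.
Qed.

(** * Negations pushed to the atoms *)

Lemma sg_false : Sg (fun _ => False).
Proof. exists (SNe tzero tzero); intro g; simpl; tauto. Qed.

Lemma sg_imp (P Q : ctx -> Prop) : Sg (fun g => ~ P g) -> Sg Q -> Sg (fun g => P g -> Q g).
Proof.
  intros HP HQ. apply (sg_ext (fun g => ~ P g \/ Q g)); [|apply sg_or; assumption].
  intro g; destruct (classic (P g)); tauto.
Qed.

Lemma sg_nand (P Q : ctx -> Prop) :
  Sg (fun g => ~ P g) -> Sg (fun g => ~ Q g) -> Sg (fun g => ~ (P g /\ Q g)).
Proof.
  intros HP HQ. apply (sg_ext (fun g => ~ P g \/ ~ Q g)); [|apply sg_or; assumption].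
  intro g; split; [tauto | apply not_and_or].
Qed.

Lemma sg_nor (P Q : ctx -> Prop) :
  Sg (fun g => ~ P g) -> Sg (fun g => ~ Q g) -> Sg (fun g => ~ (P g \/ Q g)).
Proof.
  intros HP HQ. apply (sg_ext (fun g => ~ P g /\ ~ Q g)); [|apply sg_and; assumption].
  intro g; tauto.
Qed.

Lemma sg_nimp (P Q : ctx -> Prop) :
  Sg P -> Sg (fun g => ~ Q g) -> Sg (fun g => ~ (P g -> Q g)).
Proof.
  intros HP HQ. apply (sg_ext (fun g => P g /\ ~ Q g)); [|apply sg_and; assumption].
  intro g; split; [tauto | apply imply_to_and].
Qed.

Lemma sg_nnot (P : ctx -> Prop) : Sg P -> Sg (fun g => ~ ~ P g).
Proof. apply sg_ext; intro g; split; [tauto | apply NNPP]. Qed.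

Lemma sg_nall (P : ctx -> nat -> Prop) :
  Sg (fun g => ~ P (tl g) (hd g)) -> Sg (fun g => ~ forall n, P g n).
Proof.
  intros HP. apply (sg_ext (fun g => exists n, ~ P g n)); [|apply sg_ex; exact HP].
  intro g; split; [intros [n Hn] H; apply (Hn (H n)) | apply not_all_ex_not].
Qed.

Lemma sg_neq t u : Fn t -> Fn u -> Sg (fun g => ~ t g = u g).
Proof. apply sg_ne. Qed.

Lemma sg_nle t u : Fn t -> Fn u -> Sg (fun g => ~ t g <= u g).
Proof. intros Ht Hu. apply (sg_ext (fun g => u g < t g)); [intro; lia|apply sg_lt; assumption]. Qed.

Lemma sg_nlt t u : Fn t -> Fn u -> Sg (fun g => ~ t g < u g).
Proof. intros Ht Hu. apply (sg_ext (fun g => u g <= t g)); [intro; lia|apply sg_le; assumption]. Qed.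

Ltac sg_hook := fail.

(* Decomposes a goal [Sg _], [Fn _], [FnF _], [FnF2 _] or [CM _] along the syntax of its argument, pushing negations to the atoms; [sg_hook] is extended with each new definable notion. *)
Ltac sg_step :=
  cbv beta;
  lazymatch goal with
  | |- CM _ => cm
  | _ => first
    [ assumption
    | match goal with
      | H : Fn ?t |- Fn (fun g => ?t (@?r g)) => apply (fn_ren t r H)
      | H : FnF ?F |- FnF (fun g => ?F (@?r g)) => apply (fnF_ren F r H)
      | H : FnF ?F |- Fn (fun g => ?F (@?r g) (@?t g)) =>
          apply (fn_app (fun g => F (r g)) t); [apply (fnF_ren F r H)|]
      | H : FnF2 ?F |- Fn (fun g => ?F (@?r g) (@?t g) (@?u g)) =>
          apply (fn_app2 (fun g => F (r g)) t u); [apply (fnF2_ren F r H)| |]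
      | H : Sg ?P |- Sg (fun g => ?P (@?r g)) => apply (sg_ren P r H)
      | |- Fn (fun g => hdF (@?r g) (@?t g)) =>
          apply (fn_app (fun g => hdF (r g)) t); [apply fnF_hdF|]
      | |- FnF (fun g => hdF (@?r g)) => apply fnF_hdF
      | |- Fn (fun g => hd (@?r g)) => apply fn_hd
      | |- Fn hd => apply (fn_hd (fun g => g))
      | |- FnF hdF => apply (fnF_hdF (fun g => g))
      end
    | sg_hook
    | lazymatch goal with
      | |- Fn (fun _ => ?c) => apply fn_const
      | |- Fn (fun g => S _) => apply fn_succ
      | |- Fn (fun g => _ + _) => apply fn_plus
      | |- Fn (fun g => _ * _) => apply fn_mult
      | |- Sg (fun g => _ /\ _) => apply sg_and
      | |- Sg (fun g => _ \/ _) => apply sg_or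
      | |- Sg (fun g => exists n : nat, _) => apply sg_ex
      | |- Sg (fun g => exists n : nat -> nat, _) => apply sg_exF
      | |- Sg (fun g => ~ (_ /\ _)) => apply sg_nand
      | |- Sg (fun g => ~ (_ \/ _)) => apply sg_nor
      | |- Sg (fun g => ~ ~ _) => apply sg_nnot
      | |- Sg (fun g => ~ (_ = _)) => apply sg_neq
      | |- Sg (fun g => ~ (_ <= _)) => apply sg_nle
      | |- Sg (fun g => ~ (_ < _)) => apply sg_nlt
      | |- Sg (fun g => ~ (forall n : nat, _)) => apply sg_nall
      | |- Sg (fun g => ~ (_ -> _)) => apply sg_nimp
      | |- Sg (fun g => _ = _) => apply sg_eq
      | |- Sg (fun g => _ <= _) => apply sg_le
      | |- Sg (fun g => _ < _) => apply sg_lt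
      | |- Sg (fun g => forall n : nat, _) => apply sg_all
      | |- Sg (fun g => _ -> _) => apply sg_imp
      | |- Sg (fun _ => False) => apply sg_false
      end ]
  end.

Ltac sg := repeat sg_step.

(** The table [T] of all values is guessed as a function; the recursion equations leave no choice
    for it. *)
Lemma fn_rec (a : ctx -> nat) (f : ctx -> nat -> nat -> nat) t :
  Fn a -> FnF2 f -> Fn t -> Fn (fun g => nat_rec (fun _ => nat) (a g) (f g) (t g)).
Proof.
  intros Ha Hf Ht.
  apply (fn_graph _ (fun g v => exists T : nat -> nat,
    T 0 = a g /\ (forall i, T (S i) = f g i (T i)) /\ T (t g) = v)).
  - intros g v; split.
    + intros <-. exists (nat_rec (fun _ => nat) (a g) (f g)); auto.
    + intros (T & H0 & HS & <-). induction (t g); simpl; congruence.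
  - sg.
Qed.

Lemma fn_ext t u : (forall g, t g = u g) -> Fn t -> Fn u.
Proof. intros H; apply sg_ext; intro g; rewrite H; reflexivity. Qed.

Lemma fn_sub t u : Fn t -> Fn u -> Fn (fun g => t g - u g).
Proof.
  intros Ht Hu. apply (fn_graph _ (fun g v => v + u g = t g \/ (t g <= u g /\ v = 0))).
  - intros g v; lia.
  - sg.
Qed.

Lemma fn_sqrt t : Fn t -> Fn (fun g => Nat.sqrt (t g)).
Proof.
  intros Ht. apply (fn_graph _ (fun g v => v * v <= t g /\ t g < S v * S v)).
  - intros g v; split.
    + intros <-; apply Nat.sqrt_spec; lia.
    + apply Nat.sqrt_unique.
  - sg.
Qed.

Lemma fn_pair t u : Fn t -> Fn u -> Fn (fun g => pair (t g) (u g)).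
Proof. intros; unfold pair; sg. Qed.

Lemma fn_p1 t : Fn t -> Fn (fun g => p1 (t g)).
Proof. intros; apply fn_sub; [assumption|apply fn_mult; apply fn_sqrt; assumption]. Qed.

Lemma fn_p2 t : Fn t -> Fn (fun g => p2 (t g)).
Proof. intros; apply fn_sub; [apply fn_sqrt | apply fn_p1]; assumption. Qed.

Lemma fn_dec t u : Fn t -> Fn u -> Fn (fun g => dec (t g) (u g)).
Proof.
  intros Ht Hu. apply fn_p1.
  apply (fn_ext (fun g => nat_rec (fun _ => nat) (t g) (fun _ => p2) (u g))).
  - intro g. induction (u g); simpl; congruence.
  - apply (fn_rec t (fun _ _ => p2) u); [assumption| |assumption].
    unfold FnF2. apply fn_p2. sg.
Qed.

Lemma fn_pow2 t : Fn t -> Fn (fun g => 2 ^ t g).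
Proof.
  intros Ht.
  apply (fn_ext (fun g => nat_rec (fun _ => nat) 1 (fun _ v => 2 * v) (t g))).
  - intro g. induction (t g) as [|n IH]; simpl in *; congruence.
  - apply (fn_rec (fun _ => 1) (fun _ _ v => 2 * v) t); [sg| |assumption].
    unfold FnF2; sg.
Qed.

Definition sgn (n : nat) : nat := match n with O => 0 | _ => 1 end.

Lemma fn_sgn t : Fn t -> Fn (fun g => sgn (t g)).
Proof.
  intros Ht. apply (fn_graph _ (fun g v => (t g = 0 /\ v = 0) \/ (t g <> 0 /\ v = 1))).
  - intros g v; destruct (t g); simpl; lia.
  - unfold not at 1. sg.
Qed.

(* The first [k] bits of [o] (nonzero means 1), read as a binary number with the most significant bit first: initial segments of length [k] correspond to the numbers below [2 ^ k], in lexicographic order. *)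
Fixpoint val (o : nat -> nat) (k : nat) : nat :=
  match k with O => 0 | S k => 2 * val o k + sgn (o k) end.

Lemma fn_val F t : FnF F -> Fn t -> Fn (fun g => val (F g) (t g)).
Proof.
  intros HF Ht.
  apply (fn_ext (fun g => nat_rec (fun _ => nat) 0 (fun i v => 2 * v + sgn (F g i)) (t g))).
  - intro g. induction (t g) as [|n IH]; simpl in *; congruence.
  - apply (fn_rec (fun _ => 0) (fun g i v => 2 * v + sgn (F g i)) t); [sg| |assumption].
    unfold FnF2. apply fn_plus; [sg|apply fn_sgn; sg].
Qed.

Ltac sg_hook_set := fail.
Ltac sg_hook ::= lazymatch goal with
  | |- Fn (fun g => pair _ _) => apply fn_pair
  | |- Fn (fun g => p1 _) => apply fn_p1
  | |- Fn (fun g => p2 _) => apply fn_p2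
  | |- Fn (fun g => dec _ _) => apply fn_dec
  | |- Fn (fun g => 2 ^ _) => apply fn_pow2
  | |- Fn (fun g => sgn _) => apply fn_sgn
  | |- Fn (fun g => val _ _) => apply fn_val
  | |- Fn (fun g => _ - _) => apply fn_sub
  | _ => sg_hook_set
  end.

(** * Prenex form *)

Definition tpair (t u : term) : term :=
  tplus (tmult (tplus t u) (tplus t u)) t.

Arguments tpair : simpl never.
Arguments pair : simpl never.

Lemma teval_tpair e t u : teval e (tpair t u) = pair (teval e t) (teval e u).
Proof. reflexivity. Qed.

(* Matrices: [AY q t] says that [t] belongs to the [q]-th section of the set variable. *)
Inductive af : Type :=
| AEq : term -> term -> af
| ANe : term -> term -> af
| AS : nat -> term -> term -> af
| AY : term -> term -> af
| ANY : term -> term -> af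
| AAnd : af -> af -> af
| AOr : af -> af -> af
| AEx : af -> af
| AAll : af -> af.

Fixpoint asat (s : nat -> nat -> nat) (Y : nat -> nat -> Prop) (e : nat -> nat) (f : af) : Prop :=
  match f with
  | AEq t u => teval e t = teval e u
  | ANe t u => teval e t <> teval e u
  | AS i t u => s i (teval e t) = teval e u
  | AY q t => Y (teval e q) (teval e t)
  | ANY q t => ~ Y (teval e q) (teval e t)
  | AAnd f g => asat s Y e f /\ asat s Y e g
  | AOr f g => asat s Y e f \/ asat s Y e g
  | AEx f => exists n, asat s Y (scons n e) f
  | AAll f => forall n, asat s Y (scons n e) f
  end.

Lemma asat_ext s Y Z e f :
  (forall q t, Y q t <-> Z q t) -> asat s Y e f -> asat s Z e f.
Proof.
  intro H. replace Z with Y; [auto|].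
  apply functional_extensionality; intro q; apply functional_extensionality; intro t.
  apply propositional_extensionality, H.
Qed.

Fixpoint asec (w : term) (f : af) : af :=
  match f with
  | AEq t u => AEq t u
  | ANe t u => ANe t u
  | AS i t u => AS i t u
  | AY q t => AY (tpair w q) t
  | ANY q t => ANY (tpair w q) t
  | AAnd f g => AAnd (asec w f) (asec w g)
  | AOr f g => AOr (asec w f) (asec w g)
  | AEx f => AEx (asec (tren S w) f)
  | AAll f => AAll (asec (tren S w) f)
  end.

Lemma asat_asec f : forall w s Y e,
  asat s Y e (asec w f) <-> asat s (fun q => Y (pair (teval e w) q)) e f.
Proof.
  induction f; intros w s Y e; simpl; rewrite ?teval_tpair; try tauto.
  - rewrite IHf1, IHf2; tauto.
  - rewrite IHf1, IHf2; tauto.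
  - split; intros [n H]; exists n; revert H; rewrite IHf, teval_tren; auto.
  - split; intros H n; specialize (H n); revert H; rewrite IHf, teval_tren; auto.
Qed.

(* The first function variable is traded for a graph stored in section [pair 0 0]; the old sections move to [pair 1 q]. *)
Fixpoint afun (f : af) : af :=
  match f with
  | AEq t u => AEq t u
  | ANe t u => ANe t u
  | AS O t u => AY (tpair tzero tzero) (tpair t u)
  | AS (S i) t u => AS i t u
  | AY q t => AY (tpair (numeral 1) q) t
  | ANY q t => ANY (tpair (numeral 1) q) t
  | AAnd f g => AAnd (afun f) (afun g)
  | AOr f g => AOr (afun f) (afun g)
  | AEx f => AEx (afun f)
  | AAll f => AAll (afun f)
  end.

Lemma asat_afun f : forall F s Y e,
  (forall a b, Y (pair 0 0) (pair a b) <-> F a = b) ->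
  (asat s Y e (afun f) <-> asat (fcons F s) (fun q => Y (pair 1 q)) e f).
Proof.
  induction f; intros F s Y e HF; simpl; try (destruct n; simpl); rewrite ?teval_tpair; try tauto.
  - apply (HF (teval e t) (teval e t0)).
  - rewrite IHf1, IHf2 by eassumption; tauto.
  - rewrite IHf1, IHf2 by eassumption; tauto.
  - split; intros [n H]; exists n; revert H; erewrite IHf by eassumption; auto.
  - split; intros H n; specialize (H n); revert H; erewrite IHf by eassumption; auto.
Qed.

Definition afunctional : af :=
  let y t u := AY (tpair tzero tzero) (tpair t u) in
  AAnd (AAll (AEx (y (tvar 1) (tvar 0))))
    (AAll (AAll (AAll (AOr (AOr (ANY (tpair tzero tzero) (tpair (tvar 2) (tvar 1)))
      (ANY (tpair tzero tzero) (tpair (tvar 2) (tvar 0))))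
      (AEq (tvar 1) (tvar 0)))))).

Lemma asat_afunctional s Y e :
  asat s Y e afunctional <-> exists F, forall a b, Y (pair 0 0) (pair a b) <-> F a = b.
Proof.
  simpl; split.
  - intros [Hex Hun]. apply choice in Hex as [F HF]. exists F. intros a b; split.
    + intro H. destruct (Hun a b (F a)) as [[K|K]|K]; [tauto|exfalso; apply K, HF|auto].
    + intros <-; apply HF.
  - intros [F HF]; split.
    + intro a; exists (F a). apply HF; reflexivity.
    + intros a b b'.
      destruct (classic (F a = b)) as [E|E]; [|left; left; contradict E; apply HF, E].
      destruct (classic (F a = b')) as [E'|E']; [|left; right; contradict E'; apply HF, E'].
      right; congruence.
Qed.

(** One set variable holds all witnesses in its sections: those of the two halves of a conjunction,
    those chosen for each value of a universal number variable, and the graph of a quantified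
    function. A disjunction needs no sections, since only one side has to hold. *)
Lemma prenex f : exists a, forall s e, ssat s e f <-> exists Y, asat s Y e a.
Proof.
  induction f as [t u|t u|i t u|f [a Ha] g [b Hb]|f [a Ha] g [b Hb]|f [a Ha]|f [a Ha]|f [a Ha]].
  - exists (AEq t u); intros s e; simpl; split; [exists (fun _ _ => True)|intros []]; auto.
  - exists (ANe t u); intros s e; simpl; split; [exists (fun _ _ => True)|intros []]; auto.
  - exists (AS i t u); intros s e; simpl; split; [exists (fun _ _ => True)|intros []]; auto.
  - exists (AAnd (asec (numeral 0) a) (asec (numeral 1) b)); intros s e; simpl; rewrite Ha, Hb.
    split.
    + intros [[Y1 H1] [Y2 H2]].
      exists (fun q => match p1 q with O => Y1 (p2 q) | _ => Y2 (p2 q) end).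
      rewrite !asat_asec; simpl; split.
      * apply (asat_ext _ Y1); [intros q t; simpl; rewrite p1_pair, p2_pair; tauto|exact H1].
      * apply (asat_ext _ Y2); [intros q t; simpl; rewrite p1_pair, p2_pair; tauto|exact H2].
    + intros [Y [H1 H2]]. rewrite asat_asec in H1, H2. split; eexists; eassumption.
  - exists (AOr a b); intros s e; simpl; rewrite Ha, Hb. firstorder.
  - exists (AEx a); intros s e; simpl. setoid_rewrite Ha. firstorder.
  - exists (AAll (asec (tvar 0) a)); intros s e; simpl. setoid_rewrite Ha.
    setoid_rewrite asat_asec. simpl. split.
    + intros H. apply choice in H as [Y HY].
      exists (fun q => Y (p1 q) (p2 q)). intro n.
      apply (asat_ext _ (Y n)); [intros q t; simpl; rewrite p1_pair, p2_pair; tauto|apply HY].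
    + intros [Y HY] n. exists (fun q => Y (pair n q)). apply HY.
  - exists (AAnd afunctional (afun a)); intros s e. simpl ssat. setoid_rewrite Ha.
    change (asat ?s ?Y ?e (AAnd ?f ?g)) with (asat s Y e f /\ asat s Y e g).
    split.
    + intros (F & Y & HY).
      assert (HF : forall a b, (match p1 (pair 0 0) with O => fun m => F (p1 m) = p2 m | _ => Y (p2 (pair 0 0)) end) (pair a b) <-> F a = b).
      { intros x y. rewrite p1_pair. rewrite p1_pair, p2_pair; reflexivity. }
      exists (fun q => match p1 q with O => fun m => F (p1 m) = p2 m | _ => Y (p2 q) end); split.
      * apply asat_afunctional. exists F. exact HF.
      * apply (asat_afun _ F); [exact HF|].
        apply (asat_ext _ Y); [intros q t; simpl; rewrite p1_pair, p2_pair; tauto|exact HY].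
    + intros (Y & HF & HY). apply asat_afunctional in HF as [F HF].
      rewrite asat_afun in HY by exact HF. exists F; eexists; exact HY.
Qed.

(** * From definability to [Sigma11] *)

Definition bn (x : real) (i : nat) : nat := if x i then 1 else 0.

(** All function variables stand for the oracle, as in the contexts [at_] for which these formulas
    are meant. *)
Fixpoint frozen (f : af) : formula :=
  match f with
  | AEq t u => feq t u
  | ANe t u => fneg (feq t u)
  | AS _ t u => for_ (fand (fmemX t) (feq u (numeral 1)))
                     (fand (fneg (fmemX t)) (feq u tzero))
  | AY q t => fmemY (tpair q t)
  | ANY q t => fneg (fmemY (tpair q t))
  | AAnd f g => fand (frozen f) (frozen g)
  | AOr f g => for_ (frozen f) (frozen g)
  | AEx f => fex (frozen f)
  | AAll f => fall (frozen f)
  end.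

Lemma sat_frozen x Y f : forall e,
  sat x Y e (frozen f) <-> asat (fun _ => bn x) (fun q t => Y (pair q t) = true) e f.
Proof.
  induction f; intro e; simpl; try tauto.
  - unfold bn. destruct (x (teval e t)); intuition congruence.
  - rewrite IHf1, IHf2; tauto.
  - rewrite IHf1, IHf2; tauto.
  - split; intros [n H]; exists n; apply IHf, H.
  - split; intros H n; apply IHf, H.
Qed.

Definition at_ (o : nat -> nat) (n : nat) : ctx := Ctx (fun _ => o) (scons n (fun _ => 0)).

Lemma sg_formula P : Sg P -> exists phi, forall x n,
  P (at_ (bn x) n) <-> exists Y, sat x Y (scons n (fun _ => 0)) phi.
Proof.
  intros [f Hf]. destruct (prenex f) as [a Ha].
  exists (frozen a); intros x n. rewrite Hf, Ha. simpl. split.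
  - intros [Y HY].
    exists (fun m => if excluded_middle_informative (Y (p1 m) (p2 m)) then true else false).
    rewrite sat_frozen.
    apply (asat_ext _ Y); [|exact HY].
    intros q t. rewrite p1_pair, p2_pair.
    destruct excluded_middle_informative; intuition congruence.
  - intros [Y HY]. rewrite sat_frozen in HY. eexists; exact HY.
Qed.

Theorem sg_Sigma11 P x : Sg P -> Sigma11 x (fun n => P (at_ (bn x) n)).
Proof. intros HP. destruct (sg_formula P HP) as [phi H]. exists phi; intro n; apply H. Qed.

(** * A universal [Sigma11] predicate *)

(** Atoms relate variables only, nested terms being unfolded by extra quantifiers ([pf_term]), and
    negation occurs only inside atoms. Asserting an atom then imposes at most one condition on a
    single bit, as the binary constraints require. *)
Inductive pf : Type :=
| PEq : nat -> nat -> pf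
| PNe : nat -> nat -> pf
| PSucc : nat -> nat -> pf
| PAdd : nat -> nat -> nat -> pf
| PMul : nat -> nat -> nat -> pf
| PX : bool -> nat -> pf
| PY : bool -> nat -> pf
| PAnd : pf -> pf -> pf
| POr : pf -> pf -> pf
| PEx : pf -> pf
| PAll : pf -> pf.

Definition sgb (b : bool) (n : nat) : Prop := if b then n <> 0 else n = 0.

Fixpoint psat (o Y e : nat -> nat) (f : pf) : Prop :=
  match f with
  | PEq i j => e i = e j
  | PNe i j => e i <> e j
  | PSucc i j => S (e i) = e j
  | PAdd i j k => e i + e j = e k
  | PMul i j k => e i * e j = e k
  | PX b i => sgb b (o (e i))
  | PY b i => sgb b (Y (e i))
  | PAnd f g => psat o Y e f /\ psat o Y e g
  | POr f g => psat o Y e f \/ psat o Y e g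
  | PEx f => exists n, psat o Y (scons n e) f
  | PAll f => forall n, psat o Y (scons n e) f
  end.

Lemma pf_term t : forall r j, exists f, forall o Y e,
  psat o Y e f <-> teval (fun i => e (r i)) t = e j.
Proof.
  induction t as [i| |t IH|t IHt u IHu|t IHt u IHu]; intros r j.
  - exists (PEq (r i) j); reflexivity.
  - exists (PAdd j j j); intros; simpl; lia.
  - destruct (IH (fun i => S (r i)) 0) as [f Hf].
    exists (PEx (PAnd f (PSucc 0 (S j)))); intros o Y e; simpl.
    setoid_rewrite Hf; simpl. split; [intros (n & -> & H); exact H | eauto].
  - destruct (IHt (fun i => S (S (r i))) 0) as [f Hf].
    destruct (IHu (fun i => S (S (r i))) 1) as [g Hg].
    exists (PEx (PEx (PAnd f (PAnd g (PAdd 0 1 (S (S j))))))); intros o Y e; simpl.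
    setoid_rewrite Hf; setoid_rewrite Hg; simpl.
    split; [intros (n & m & -> & -> & H); exact H | intros H; do 2 eexists; eauto].
  - destruct (IHt (fun i => S (S (r i))) 0) as [f Hf].
    destruct (IHu (fun i => S (S (r i))) 1) as [g Hg].
    exists (PEx (PEx (PAnd f (PAnd g (PMul 0 1 (S (S j))))))); intros o Y e; simpl.
    setoid_rewrite Hf; setoid_rewrite Hg; simpl.
    split; [intros (n & m & -> & -> & H); exact H | intros H; do 2 eexists; eauto].
Qed.

Definition Pf (P : (nat -> nat) -> (nat -> nat) -> (nat -> nat) -> Prop) : Prop :=
  exists f, forall o Y e, psat o Y e f <-> P o Y e.

Lemma pf_bin (R : nat -> nat -> Prop) a t u :
  (forall o Y e, psat o Y e a <-> R (e 1) (e 0)) ->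
  Pf (fun o Y e => R (teval e t) (teval e u)).
Proof.
  intros Ha.
  destruct (pf_term t (fun i => S (S i)) 1) as [f Hf].
  destruct (pf_term u (fun i => S (S i)) 0) as [g Hg].
  exists (PEx (PEx (PAnd f (PAnd g a)))); intros o Y e; simpl.
  setoid_rewrite Hf; setoid_rewrite Hg; setoid_rewrite Ha; simpl.
  split; [intros (n & m & <- & <- & H); exact H | intros H; do 2 eexists; eauto].
Qed.

Lemma pf_lt t u : Pf (fun o Y e => teval e t < teval e u).
Proof.
  apply (pf_bin lt (PEx (PEx (PAnd (PSucc 0 1) (PAdd 3 1 2))))).
  intros o Y e; simpl. split.
  - intros (n & m & H & K); lia.
  - intro H; exists (e 0 - e 1), (e 0 - S (e 1)); lia.
Qed.

Lemma pf_nlt t u : Pf (fun o Y e => ~ teval e t < teval e u).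
Proof.
  apply (pf_bin (fun a b => ~ a < b) (PEx (PAdd 1 0 2))).
  intros o Y e; simpl. split.
  - intros (n & H); lia.
  - intro H; exists (e 1 - e 0); lia.
Qed.

Lemma pf_mem (F : bool -> nat -> pf) (V : (nat -> nat) -> (nat -> nat) -> nat -> nat) b t :
  (forall o Y e i, psat o Y e (F b i) <-> sgb b (V o Y (e i))) ->
  Pf (fun o Y e => sgb b (V o Y (teval e t))).
Proof.
  intros HF. destruct (pf_term t S 0) as [f Hf].
  exists (PEx (PAnd f (F b 0))); intros o Y e; simpl.
  setoid_rewrite Hf; setoid_rewrite HF; simpl. split.
  - intros (n & <- & H); exact H.
  - intro H; eauto.
Qed.

Lemma sgb_bn x b i : sgb b (bn x i) <-> x i = b.
Proof. unfold bn; destruct b, (x i); simpl; intuition congruence. Qed.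

(** The negation is carried along because [pf] has none: the two halves change places at [fneg]. *)
Lemma pf_formula phi :
  (exists f, forall x Y e, psat (bn x) Y e f <-> sat x (fun p => negb (Y p =? 0)) e phi) /\
  (exists f, forall x Y e, psat (bn x) Y e f <-> ~ sat x (fun p => negb (Y p =? 0)) e phi).
Proof.
  assert (Y_true : forall (Y : nat -> nat) p, sgb true (Y p) <-> negb (Y p =? 0) = true).
  { intros Y p; simpl; destruct (Nat.eqb_spec (Y p) 0); simpl; intuition congruence. }
  assert (Y_false : forall (Y : nat -> nat) p, sgb false (Y p) <-> ~ negb (Y p =? 0) = true).
  { intros Y p; simpl; destruct (Nat.eqb_spec (Y p) 0); simpl; intuition congruence. }
  induction phi as [t u|t u|t|t|phi [IH1 IH2]|phi [[f Hf] [f' Hf']] psi [[g Hg] [g' Hg']]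
    |phi [[f Hf] [f' Hf']] psi [[g Hg] [g' Hg']]|phi [[f Hf] [f' Hf']]|phi [[f Hf] [f' Hf']]];
    simpl sat.
  - split.
    + destruct (pf_bin (fun a b => a = b) (PEq 1 0) t u) as [f Hf]; [reflexivity|].
      exists f; intros; apply Hf.
    + destruct (pf_bin (fun a b => a <> b) (PNe 1 0) t u) as [f Hf]; [reflexivity|].
      exists f; intros; apply Hf.
  - split.
    + destruct (pf_lt t u) as [f Hf]. exists f; intros; apply Hf.
    + destruct (pf_nlt t u) as [f Hf]. exists f; intros; apply Hf.
  - split.
    + destruct (pf_mem PX (fun o Y => o) true t) as [f Hf]; [reflexivity|].
      exists f; intros; rewrite Hf. apply sgb_bn.
    + destruct (pf_mem PX (fun o Y => o) false t) as [f Hf]; [reflexivity|].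
      exists f; intros; rewrite Hf, sgb_bn. destruct (x (teval e t)); intuition congruence.
  - split.
    + destruct (pf_mem PY (fun o Y => Y) true t) as [f Hf]; [reflexivity|].
      exists f; intros; rewrite Hf. apply Y_true.
    + destruct (pf_mem PY (fun o Y => Y) false t) as [f Hf]; [reflexivity|].
      exists f; intros; rewrite Hf. apply Y_false.
  - split; [exact IH2|]. destruct IH1 as [f Hf]; exists f; intros; rewrite Hf.
    split; [tauto | apply NNPP].
  - split.
    + exists (PAnd f g); intros; simpl; rewrite Hf, Hg; reflexivity.
    + exists (POr f' g'); intros; simpl; rewrite Hf', Hg'.
      split; [tauto | apply not_and_or].
  - split.
    + exists (POr f g); intros; simpl; rewrite Hf, Hg; reflexivity.
    + exists (PAnd f' g'); intros; simpl; rewrite Hf', Hg'. tauto.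
  - split.
    + exists (PEx f); intros; simpl; setoid_rewrite Hf; reflexivity.
    + exists (PAll f'); intros; simpl; setoid_rewrite Hf'.
      split; [intros H [n Hn]; apply (H n Hn) | apply not_ex_all_not].
  - split.
    + exists (PAll f); intros; simpl; setoid_rewrite Hf; reflexivity.
    + exists (PEx f'); intros; simpl; setoid_rewrite Hf'.
      split; [intros [n Hn] H; apply (Hn (H n)) | apply not_all_ex_not].
Qed.

Fixpoint code (f : pf) : nat :=
  match f with
  | PEq i j => pair 0 (pair i j)
  | PNe i j => pair 1 (pair i j)
  | PSucc i j => pair 2 (pair i j)
  | PAdd i j k => pair 3 (pair i (pair j k))
  | PMul i j k => pair 4 (pair i (pair j k))
  | PX true i => pair 5 (pair i 0)
  | PX false i => pair 6 (pair i 0)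
  | PY true i => pair 7 (pair i 0)
  | PY false i => pair 8 (pair i 0)
  | PAnd f g => pair 9 (pair (code f) (code g))
  | POr f g => pair 10 (pair (code f) (code g))
  | PEx f => pair 11 (pair (code f) 0)
  | PAll f => pair 12 (pair (code f) 0)
  end.

(** The tag 13 belongs to no formula code, so these positions never clash with instances of formulas
    ([code_not_ypos]). *)
Definition ypos (p : nat) : nat := pair (pair 13 0) p.

(** One clause for each tag of [code]. The clauses are implications between equations so that the
    negation is definable too: in [Sim], tree steps and hence constraints occur as hypotheses. *)
Definition conb (T A B c ox a b j : nat) : Prop :=
  (T = 0 -> dec c A = dec c B) /\
  (T = 1 -> ~ dec c A = dec c B) /\
  (T = 2 -> S (dec c A) = dec c B) /\
  (T = 3 -> dec c A + dec c (p1 B) = dec c (p2 B)) /\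
  (T = 4 -> dec c A * dec c (p1 B) = dec c (p2 B)) /\
  (T = 5 -> j = dec c A -> ~ ox = 0) /\
  (T = 6 -> j = dec c A -> ox = 0) /\
  (T = 7 -> j = ypos (dec c A) -> ~ b = 0) /\
  (T = 8 -> j = ypos (dec c A) -> b = 0) /\
  (T = 9 -> j = pair A c \/ j = pair B c -> ~ b = 0) /\
  (T = 10 -> (a = 1 -> j = pair A c -> ~ b = 0) /\ (~ a = 1 -> j = pair B c -> ~ b = 0)) /\
  (T = 11 -> forall v, a = S v -> j = pair A (pair v c) -> ~ b = 0) /\
  (T = 12 -> forall v, j = pair A (pair v c) -> ~ b = 0).

(* Truth of positive formulas as a system of binary constraints on an assignment [w : nat -> nat]: the position [m = pair (code f) c] is the instance of [f] under the environment [dec c], and it is asserted when [w m] is nonzero, [pred (w m)] being the witness for a disjunction or an existential quantifier; the set variable is read off the positions [ypos p]. [con (o j) (w m) (w j) m j] says that the value at [j] complies with what is asserted at [m]. *)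
Definition con (ox a b m j : nat) : Prop :=
  ~ a = 0 -> conb (p1 (p1 m)) (p1 (p2 (p1 m))) (p2 (p2 (p1 m))) (p2 m) ox a b j.

Lemma con_pair T A B c ox a b j :
  con ox a b (pair (pair T (pair A B)) c) j = (~ a = 0 -> conb T A B c ox a b j).
Proof. unfold con. repeat (rewrite p1_pair || rewrite p2_pair). reflexivity. Qed.

Lemma sg_conb T A B c ox a b j :
  Fn T -> Fn A -> Fn B -> Fn c -> Fn ox -> Fn a -> Fn b -> Fn j ->
  Sg (fun g => conb (T g) (A g) (B g) (c g) (ox g) (a g) (b g) (j g)).
Proof. intros; unfold conb, ypos; sg. Qed.

Lemma sg_nconb T A B c ox a b j :
  Fn T -> Fn A -> Fn B -> Fn c -> Fn ox -> Fn a -> Fn b -> Fn j ->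
  Sg (fun g => ~ conb (T g) (A g) (B g) (c g) (ox g) (a g) (b g) (j g)).
Proof. intros; unfold conb, ypos; sg. Qed.

Definition U (o : nat -> nat) (m : nat) : Prop :=
  exists w, w m <> 0 /\ forall i j, con (o j) (w i) (w j) i j.

Ltac con_at K j := destruct (K j) as
  (K0 & K1 & K2 & K3 & K4 & K5 & K6 & K7 & K8 & K9 & K10 & K11 & K12).

Lemma con_sound o w :
  (forall i j, con (o j) (w i) (w j) i j) -> forall f c,
  w (pair (code f) c) <> 0 -> psat o (fun p => w (ypos p)) (dec c) f.
Proof.
  intros H.
  assert (K : forall T A B c, w (pair (pair T (pair A B)) c) <> 0 ->
    forall j, conb T A B c (o j) (w (pair (pair T (pair A B)) c)) (w j) j).
  { intros T A B c Hm j. specialize (H (pair (pair T (pair A B)) c) j).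
    rewrite con_pair in H. exact (H Hm). }
  clear H.
  induction f as [i j|i j|i j|i j k|i j k|[] i|[] i|f IHf g IHg|f IHf g IHg|f IHf|f IHf];
    intros c Hc; simpl in *; specialize (K _ _ _ _ Hc); unfold conb in K.
  (* The arithmetical clauses do not mention [j], so any position will do. *)
  - con_at K 0. auto.
  - con_at K 0. auto.
  - con_at K 0. auto.
  - con_at K 0. rewrite p1_pair, p2_pair in K3; auto.
  - con_at K 0. rewrite p1_pair, p2_pair in K4; auto.
  - con_at K (dec c i). auto.
  - con_at K (dec c i). auto.
  - con_at K (ypos (dec c i)). auto.
  - con_at K (ypos (dec c i)). auto.
  - split; [apply IHf | apply IHg].
    + con_at K (pair (code f) c). apply K9; auto.
    + con_at K (pair (code g) c). apply K9; auto.
  - destruct (Nat.eq_dec (w (pair (pair 10 (pair (code f) (code g))) c)) 1).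
    + left. apply IHf. con_at K (pair (code f) c). apply (proj1 (K10 eq_refl)); auto.
    + right. apply IHg. con_at K (pair (code g) c). apply (proj2 (K10 eq_refl)); auto.
  - destruct (w (pair (pair 11 (pair (code f) 0)) c)) as [|v]; [tauto|].
    exists v. rewrite <- dec_pair. apply IHf. con_at K (pair (code f) (pair v c)).
    apply (K11 eq_refl v); auto.
  - intro v. rewrite <- dec_pair. apply IHf. con_at K (pair (code f) (pair v c)).
    apply (K12 eq_refl v); auto.
Qed.

Definition good (o Y : nat -> nat) (f : pf) (c a : nat) : Prop :=
  a <> 0 /\
  match f with
  | POr f g => if a =? 1 then psat o Y (dec c) f else psat o Y (dec c) g
  | PEx f => psat o Y (dec (pair (pred a) c)) f
  | _ => True
  end.

Lemma good_ex o Y f c : psat o Y (dec c) f -> exists a, good o Y f c a.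
Proof.
  unfold good; destruct f; simpl; intro H; try (exists 1; split; [discriminate|exact I]).
  - destruct H; [exists 1|exists 2]; split; auto.
  - destruct H as [n H]; exists (S n); split; [discriminate|]. rewrite dec_pair; exact H.
Qed.

Lemma code_not_ypos f c p : pair (code f) c <> ypos p.
Proof.
  intros H. apply pair_inj in H as [H _].
  destruct f as [| | | | |[]|[]| | | |]; apply pair_inj in H as [H _]; discriminate.
Qed.

(** The assignment copies [Y] at the positions [ypos p], carries a witness in the sense of [good] at
    the true instances, and vanishes elsewhere. *)
Lemma con_complete o Y : exists w,
  (forall p, w (ypos p) = Y p) /\
  (forall f c, psat o Y (dec c) f -> w (pair (code f) c) <> 0) /\
  (forall i j, con (o j) (w i) (w j) i j).
Proof.
  assert (E : forall m, exists a,
    (forall p, m = ypos p -> a = Y p) /\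
    ((exists f c, m = pair (code f) c /\ psat o Y (dec c) f) -> a <> 0) /\
    (a <> 0 -> (forall p, m <> ypos p) ->
      exists f c, m = pair (code f) c /\ psat o Y (dec c) f /\ good o Y f c a)).
  { intros m. destruct (classic (exists p, m = ypos p)) as [[p ->]|Hp].
    - exists (Y p); repeat split.
      + intros q Hq. apply pair_inj in Hq as [_ ->]; reflexivity.
      + intros (f & c & Hm & _). symmetry in Hm; apply code_not_ypos in Hm; contradiction.
      + intros _ H. exfalso; apply (H p); reflexivity.
    - destruct (classic (exists f c, m = pair (code f) c /\ psat o Y (dec c) f)) as [(f & c & Hm & Hs)|Hn].
      + destruct (good_ex _ _ _ _ Hs) as [a Ha]. exists a; repeat split.
        * intros p ->; exfalso; apply Hp; eauto.
        * intros _; apply Ha.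
        * intros _ _; exists f, c; auto.
      + exists 0; repeat split; try tauto. intros p ->; exfalso; apply Hp; eauto. }
  apply choice in E as [w Hw]. exists w.
  assert (Hf : forall f c, psat o Y (dec c) f -> w (pair (code f) c) <> 0).
  { intros f c Hs. apply (Hw (pair (code f) c)); eauto. }
  split; [|split]; [intro p; apply (Hw (ypos p)); reflexivity | exact Hf |].
  intros m j Hm.
  destruct (classic (exists p, m = ypos p)) as [[p ->]|Hp].
  { unfold ypos. rewrite !p1_pair. unfold conb. repeat split; discriminate. }
  destruct (proj2 (proj2 (Hw m)) Hm) as (f & c & Em & Hs & Hg).
  { intros p ->; apply Hp; eauto. }
  revert Hm. fold (con (o j) (w m) (w j) m j). unfold good in Hg.
  assert (Hy : forall p, j = ypos p -> w j = Y p) by (intros; apply (Hw j); assumption).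
  destruct f as [i k|i k|i k|i k l|i k l|[] i|[] i|f g|f g|f|f];
    simpl in Em, Hs; rewrite Em at 2; rewrite con_pair; intros _; unfold conb;
    repeat split; try discriminate; intros E; rewrite ?p1_pair, ?p2_pair; try assumption.
  - intros ->; exact Hs.
  - intros ->; exact Hs.
  - intro K; rewrite (Hy _ K); exact Hs.
  - intro K; rewrite (Hy _ K); exact Hs.
  - intros [-> | ->]; apply Hf, Hs.
  - intros ->. rewrite E in Hg. apply Hf, Hg.
  - intros ->. apply Nat.eqb_neq in E. rewrite E in Hg. apply Hf, Hg.
  - intros v K ->. rewrite K in Hg. apply Hf, Hg.
  - intros v ->. apply Hf. rewrite dec_pair. apply Hs.
Qed.

Lemma U_code o f c : U o (pair (code f) c) <-> exists Y, psat o Y (dec c) f.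
Proof.
  split.
  - intros (w & Hm & H). eexists. apply (con_sound o w H), Hm.
  - intros (Y & HY). destruct (con_complete o Y) as (w & _ & H1 & H2).
    exists w; auto.
Qed.

Definition arg (q n : nat) : nat := pair q (pair n 0).

Lemma Sigma11_U phi : exists q, forall x n,
  (exists Y, sat x Y (scons n (fun _ => 0)) phi) <-> U (bn x) (arg q n).
Proof.
  destruct (proj1 (pf_formula phi)) as [f Hf]. exists (code f); intros x n.
  unfold arg. rewrite U_code, dec_pair, dec_0. setoid_rewrite Hf. split.
  - intros [Y HY]. exists (bn Y).
    replace (fun p => negb (bn Y p =? 0)) with Y; [exact HY|].
    apply functional_extensionality; intro p; unfold bn; destruct (Y p); reflexivity.
  - intros [Y HY]. eexists; exact HY.
Qed.

(** The index [q] is the same for all oracles, which is what allows measures to be taken over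
    [x]. *)
Lemma sg_U P : Sg P -> exists q, forall x n, P (at_ (bn x) n) <-> U (bn x) (arg q n).
Proof.
  intros HP. destruct (sg_formula P HP) as [phi Hphi]. destruct (Sigma11_U phi) as [q Hq].
  exists q; intros x n. rewrite Hphi; apply Hq.
Qed.

Lemma sg_con ox a b m j :
  Fn ox -> Fn a -> Fn b -> Fn m -> Fn j ->
  Sg (fun g => con (ox g) (a g) (b g) (m g) (j g)).
Proof.
  intros. unfold con. apply sg_imp; [sg|].
  apply (sg_conb (fun g => p1 (p1 (m g))) (fun g => p1 (p2 (p1 (m g)))) (fun g => p2 (p2 (p1 (m g))))
    (fun g => p2 (m g))); sg.
Qed.

Lemma sg_ncon ox a b m j :
  Fn ox -> Fn a -> Fn b -> Fn m -> Fn j ->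
  Sg (fun g => ~ con (ox g) (a g) (b g) (m g) (j g)).
Proof.
  intros. unfold con. apply sg_nimp; [sg|].
  apply (sg_nconb (fun g => p1 (p1 (m g))) (fun g => p1 (p2 (p1 (m g)))) (fun g => p2 (p2 (p1 (m g))))
    (fun g => p2 (m g))); sg.
Qed.

Ltac sg_hook_more := fail.
Ltac sg_hook_set ::= lazymatch goal with
  | |- Sg (fun g => con _ _ _ _ _) => apply sg_con
  | |- Sg (fun g => ~ con _ _ _ _ _) => apply sg_ncon
  | _ => sg_hook_more
  end.

(** * Counting *)

Definition ind (P : Prop) : nat := if excluded_middle_informative P then 1 else 0.

Fixpoint cnt (N : nat) (P : nat -> Prop) : nat :=
  match N with O => 0 | S n => cnt n P + ind (P n) end.

Lemma ind_true (P : Prop) : P -> ind P = 1.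
Proof. unfold ind; destruct excluded_middle_informative; tauto. Qed.

Lemma ind_false (P : Prop) : ~ P -> ind P = 0.
Proof. unfold ind; destruct excluded_middle_informative; tauto. Qed.

Lemma cnt_le N (P Q : nat -> Prop) :
  (forall t, t < N -> P t -> Q t) -> cnt N P <= cnt N Q.
Proof.
  induction N as [|n IH]; intro H; simpl; [lia|].
  assert (IH' : cnt n P <= cnt n Q) by (apply IH; intros; apply H; [lia|assumption]).
  destruct (classic (P n)) as [p|p].
  - rewrite (ind_true (P n)), (ind_true (Q n)) by auto. lia.
  - rewrite (ind_false (P n)) by auto. lia.
Qed.

Lemma cnt_ext N (P Q : nat -> Prop) :
  (forall t, t < N -> P t <-> Q t) -> cnt N P = cnt N Q.
Proof. intro H; apply Nat.le_antisymm; apply cnt_le; intros; apply H; assumption. Qed.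

Lemma cnt_modular N (P Q : nat -> Prop) :
  cnt N (fun t => P t \/ Q t) + cnt N (fun t => P t /\ Q t) = cnt N P + cnt N Q.
Proof.
  induction N as [|n IH]; simpl; [reflexivity|]. unfold ind in *.
  repeat destruct excluded_middle_informative; try tauto; lia.
Qed.

Lemma cnt_not N (P : nat -> Prop) : cnt N P + cnt N (fun t => ~ P t) = N.
Proof.
  induction N as [|n IH]; simpl; [reflexivity|]. unfold ind in *.
  repeat destruct excluded_middle_informative; try tauto; lia.
Qed.

Lemma cnt_all N (P : nat -> Prop) : (forall t, t < N -> P t) -> cnt N P = N.
Proof.
  intro H. pose proof (cnt_not N P).
  assert (cnt N (fun t => ~ P t) <= cnt N (fun _ => False)) by (apply cnt_le; firstorder).
  assert (cnt N (fun _ => False) = 0).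
  { clear. induction N; simpl; [reflexivity|]. rewrite ind_false by tauto. lia. }
  lia.
Qed.

Lemma cnt_none N (P : nat -> Prop) : (forall t, t < N -> ~ P t) -> cnt N P = 0.
Proof. intro H. pose proof (cnt_not N P). rewrite (cnt_all N (fun t => ~ P t)) in *; auto; lia. Qed.

Lemma cnt_split N (P : nat -> Prop) :
  cnt (2 * N) P = cnt N (fun t => P (2 * t)) + cnt N (fun t => P (2 * t + 1)).
Proof.
  induction N as [|n IH]; [reflexivity|].
  replace (2 * S n) with (S (S (2 * n))) by lia.
  cbn [cnt]. rewrite IH. replace (S (2 * n)) with (2 * n + 1) by lia. lia.
Qed.

Lemma cnt_double N (P Q : nat -> Prop) :
  (forall t, t < N -> P t -> Q (2 * t) /\ Q (2 * t + 1)) -> 2 * cnt N P <= cnt (2 * N) Q.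
Proof.
  intro H. rewrite cnt_split.
  assert (cnt N P <= cnt N (fun t => Q (2 * t))) by (apply cnt_le; intros; apply H; auto).
  assert (cnt N P <= cnt N (fun t => Q (2 * t + 1))) by (apply cnt_le; intros; apply H; auto).
  lia.
Qed.

(** An injective list of members expresses the bound with [Q] occurring only positively, so that it
    stays Sigma11 when [Q] is; [MuGt] uses this form. *)
Lemma cnt_ge N M (Q : nat -> Prop) :
  N <= cnt M Q <->
  exists Z : nat -> nat, forall i, i < N -> Z i < M /\ Q (Z i) /\ forall j, j < i -> ~ Z j = Z i.
Proof.
  split.
  - revert N; induction M as [|m IH]; intros N H; simpl in H.
    + exists (fun _ => 0); intros; lia.
    + destruct (classic (Q m)) as [q|q].
      * rewrite ind_true in H by exact q.
        destruct (IH (N - 1)) as [Z HZ]; [lia|].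
        exists (fun i => if i =? N - 1 then m else Z i). intros i Hi.
        destruct (Nat.eqb_spec i (N - 1)) as [->|Hne].
        -- repeat split; [lia|exact q|]. intros j Hj.
           destruct (Nat.eqb_spec j (N - 1)); [lia|]. specialize (HZ j ltac:(lia)). lia.
        -- destruct (HZ i) as (H1 & H2 & H3); [lia|]. repeat split; [lia|exact H2|].
           intros j Hj. destruct (Nat.eqb_spec j (N - 1)); [lia|]. apply H3, Hj.
      * rewrite ind_false in H by exact q.
        destruct (IH N) as [Z HZ]; [lia|]. exists Z; intros i Hi.
        destruct (HZ i Hi) as (H1 & H2 & H3); auto.
  - intros [Z HZ].
    assert (E : exists l, NoDup l /\ length l = cnt M Q /\ forall t, In t l <-> t < M /\ Q t).
    { clear HZ. induction M as [|m (l & H1 & H2 & H3)]; simpl.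
      - exists nil. split; [constructor|split; [reflexivity|]]. intro t; split; [easy|lia].
      - destruct (classic (Q m)) as [q|q].
        + exists (m :: l). rewrite ind_true by exact q. simpl. split; [|split; [|split; [intro H; split|]]].
          * constructor; [|assumption]. rewrite H3; lia.
          * lia.
          * destruct H as [<-|H]; [lia|]. apply H3 in H; lia.
          * destruct H as [<-|H]; [assumption|]. apply H3 in H; tauto.
          * intros [Ht Qt]. destruct (Nat.eq_dec m t); [left; auto|right; apply H3; split; [lia|exact Qt]].
        + exists l. rewrite ind_false by exact q. split; [assumption|split; [lia|split; [intro H; split|]]].
          * apply H3 in H; lia.
          * apply H3 in H; tauto.
          * intros [Ht Qt]. apply H3. split; [|exact Qt].
            destruct (Nat.eq_dec m t); [subst; tauto|lia]. }
    destruct E as (l & H1 & H2 & H3). rewrite <- H2.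
    rewrite <- (length_seq N 0), <- (length_map Z).
    apply NoDup_incl_length.
    + assert (forall n, n <= N -> NoDup (map Z (seq 0 n))); [|auto].
      induction n as [|n IH]; intro Hn; [constructor|].
      rewrite seq_S, map_app. apply NoDup_app; [apply IH; lia | constructor; [easy|constructor] |].
      intros a Ha [<-|[]]. apply in_map_iff in Ha as (j & E & Hj). apply in_seq in Hj.
      apply (HZ n ltac:(lia)) in E; [exact E|lia].
    + intros a Ha. apply in_map_iff in Ha as (j & <- & Hj). apply in_seq in Hj.
      apply H3. destruct (HZ j) as (A & B & _); [lia|auto].
Qed.

(** * Binary expansions and compactness *)

Definition vb (x : real) (k : nat) : nat := val (bn x) k.

Lemma sgn_le n : sgn n <= 1.
Proof. destruct n; simpl; lia. Qed.

Lemma val_lt o k : val o k < 2 ^ k.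
Proof. induction k; simpl; [lia|]. pose proof (sgn_le (o k)); lia. Qed.

Lemma vb_S x k : vb x (S k) = 2 * vb x k + (if x k then 1 else 0).
Proof.
  unfold vb; simpl. replace (sgn (bn x k)) with (if x k then 1 else 0); [reflexivity|].
  unfold bn; destruct (x k); reflexivity.
Qed.

Lemma val_ext o o' k : (forall i, i < k -> sgn (o i) = sgn (o' i)) -> val o k = val o' k.
Proof.
  induction k as [|k IH]; intro H; simpl; [reflexivity|].
  rewrite IH, (H k); auto.
Qed.

Lemma val_inj o o' k : val o k = val o' k -> forall i, i < k -> sgn (o i) = sgn (o' i).
Proof.
  induction k as [|k IH]; simpl; intros H i Hi; [lia|].
  pose proof (sgn_le (o k)); pose proof (sgn_le (o' k)).
  destruct (Nat.eq_dec i k) as [->|]; [lia|]. apply IH; lia.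
Qed.

Lemma vb_surj k t : t < 2 ^ k -> exists x, vb x k = t.
Proof.
  revert t; induction k as [|k IH]; intros t Ht; simpl in Ht.
  - exists (fun _ => false); unfold vb; simpl; lia.
  - destruct (IH (t / 2)) as [x Hx]; [apply Nat.Div0.div_lt_upper_bound; lia|].
    exists (fun i => if i =? k then t mod 2 =? 1 else x i).
    rewrite vb_S, Nat.eqb_refl.
    replace (vb _ k) with (vb x k).
    + rewrite Hx. pose proof (Nat.div_mod_eq t 2). pose proof (Nat.mod_upper_bound t 2).
      destruct (Nat.eqb_spec (t mod 2) 1); lia.
    + apply val_ext; intros i Hi. unfold bn. destruct (Nat.eqb_spec i k); [lia|reflexivity].
Qed.

Definition upd (g : nat -> nat) (k v i : nat) : nat := if i =? k then v else g i.

Lemma upd_same g k v : upd g k v k = v.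
Proof. unfold upd; rewrite Nat.eqb_refl; reflexivity. Qed.

Lemma upd_lt g k v i : i < k -> upd g k v i = g i.
Proof. unfold upd; intro; destruct (Nat.eqb_spec i k); [lia|reflexivity]. Qed.

Lemma dependent_build (E : nat -> (nat -> nat) -> Prop) :
  (forall k g g', (forall i, i < k -> g i = g' i) -> E k g -> E k g') ->
  E 0 (fun _ => 0) ->
  (forall k g, E k g -> exists v, E (S k) (upd g k v)) ->
  exists g, forall k, E k g.
Proof.
  intros Hloc H0 HS.
  assert (C : forall kg : nat * (nat -> nat), exists v,
    E (fst kg) (snd kg) -> E (S (fst kg)) (upd (snd kg) (fst kg) v)).
  { intros [k g]; simpl. destruct (classic (E k g)) as [H|H].
    - destruct (HS k g H) as [v Hv]; exists v; auto.
    - exists 0; tauto. }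
  apply choice in C as [f Hf].
  set (G := fix G k := match k with O => fun _ => 0 | S k => upd (G k) k (f (k, G k)) end).
  assert (HG : forall k, E k (G k)).
  { induction k as [|k IH]; [exact H0|]. apply (Hf (k, G k)), IH. }
  assert (Hst : forall d i, G (S i + d) i = G (S i) i).
  { induction d as [|d IH]; intro i; [rewrite Nat.add_0_r; reflexivity|].
    rewrite <- plus_n_Sm. cbn [G Nat.add]. rewrite upd_lt by lia. apply IH. }
  exists (fun i => G (S i) i). intro k. apply (Hloc k (G k)); [|apply HG].
  intros i Hi. rewrite <- (Hst (k - S i) i). f_equal; lia.
Qed.

Lemma finite_bound (N : nat -> nat) m : exists M, forall v, v <= m -> N v <= M.
Proof.
  induction m as [|m [M HM]].
  - exists (N 0); intros v Hv. replace v with 0 by lia; lia.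
  - exists (M + N (S m)); intros v Hv. destruct (Nat.eq_dec v (S m)) as [->|]; [lia|].
    specialize (HM v); lia.
Qed.

Lemma konig (h : nat -> nat) (P : nat -> (nat -> nat) -> Prop) :
  (forall k g g', (forall i, i < k -> g i = g' i) -> P k g -> P k g') ->
  (forall k g, P (S k) g -> P k g) ->
  (forall k, exists g, (forall i, i < k -> g i <= h i) /\ P k g) ->
  exists g, (forall i, g i <= h i) /\ forall k, P k g.
Proof.
  intros Hloc Hdec Hex.
  assert (Hdec' : forall d k g, P (d + k) g -> P k g) by (induction d; simpl; auto).
  destruct (dependent_build (fun k g => (forall i, i < k -> g i <= h i) /\
    forall n, k <= n -> exists g', (forall i, i < k -> g' i = g i) /\
      (forall i, i < n -> g' i <= h i) /\ P n g')) as [g Hg].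
  - intros k g g' E [H1 H2]; split.
    + intros i Hi; rewrite <- E; auto.
    + intros n Hn. destruct (H2 n Hn) as (w & A & B & C). exists w; repeat split; auto.
      intros i Hi; rewrite <- E; auto.
  - split; [lia|]. intros n _. destruct (Hex n) as (w & A & B). exists w; repeat split; auto; lia.
  - intros k g [H1 H2]. apply NNPP; intro Hno.
    (* If no value at [k] were extendible to all levels, each [v <= h k] would die at some level
       [N v]; an attempt reaching beyond all of these levels is a contradiction. *)
    assert (C : forall v, exists n, v <= h k -> S k <= n /\
      ~ exists g', (forall i, i < S k -> g' i = upd g k v i) /\ (forall i, i < n -> g' i <= h i) /\ P n g').
    { intro v. apply NNPP; intro Hv. apply Hno. exists v.
      assert (Hvk : v <= h k) by (apply NNPP; intro; apply Hv; exists 0; tauto).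
      split.
      - intros i Hi. destruct (Nat.eq_dec i k) as [->|]; [rewrite upd_same; exact Hvk|].
        rewrite upd_lt by lia. apply H1; lia.
      - intros n Hn. apply NNPP; intro K. apply Hv. exists n; auto. }
    apply choice in C as [N HN]. destruct (finite_bound N (h k)) as [M HM].
    destruct (H2 (S k + M)) as (w & A & B & C); [lia|].
    assert (Hw : w k <= h k) by (apply B; lia).
    destruct (HN (w k) Hw) as [L1 L2]. apply L2. exists w. pose proof (HM _ Hw). repeat split.
    + intros i Hi. destruct (Nat.eq_dec i k) as [->|]; [rewrite upd_same; reflexivity|].
      rewrite upd_lt by lia. apply A; lia.
    + intros i Hi; apply B; lia.
    + apply (Hdec' (S k + M - N (w k))). replace (_ + _) with (S k + M) by lia. exact C.
  - exists g; split.
    + intro i. apply (proj1 (Hg (S i))); lia.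
    + intro k. destruct (proj2 (Hg k) k) as (w & A & _ & C); [lia|]. apply (Hloc k w); auto.
Qed.

(** * Outer measure *)

Local Open Scope R_scope.

Definition lv (u : nat -> nat -> Prop) (k : nat) : R := INR (cnt (2 ^ k) (u k)) / 2 ^ k.

Definition mono (u : nat -> nat -> Prop) : Prop :=
  forall k t, u k t -> u (S k) (2 * t)%nat /\ u (S k) (2 * t + 1)%nat.

Definition covers (u : nat -> nat -> Prop) (A : real -> Prop) : Prop :=
  forall x, A x -> exists k, u k (vb x k).

(* [u k t] says that the cylinder of the length [k] string with value [t] is contained in the open set coded by [u]; the measure of that open set is the supremum of [lv u k]. *)
Definition Cov (A : real -> Prop) (r : R) : Prop :=
  exists u, mono u /\ covers u A /\ forall k, lv u k <= r.

Lemma pow2_pos k : 0 < 2 ^ k.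
Proof. apply pow_lt; lra. Qed.

Lemma INR_pow2 k : INR (2 ^ k) = 2 ^ k.
Proof. rewrite pow_INR; reflexivity. Qed.

Lemma lv_le u v k r : (forall t, (t < 2 ^ k)%nat -> u k t -> v k t) -> lv v k <= r -> lv u k <= r.
Proof.
  intros H Hr. apply Rle_trans with (lv v k); [|exact Hr]. unfold lv, Rdiv.
  apply Rmult_le_compat_r; [left; apply Rinv_0_lt_compat, pow2_pos|].
  apply le_INR, cnt_le, H.
Qed.

Lemma lv_ge0 u k : 0 <= lv u k.
Proof. unfold lv. apply Rmult_le_pos; [apply pos_INR | left; apply Rinv_0_lt_compat, pow2_pos]. Qed.

Lemma lv_all u k : (forall t, (t < 2 ^ k)%nat -> u k t) -> lv u k = 1.
Proof.
  intro H. unfold lv. rewrite cnt_all, INR_pow2 by exact H. field.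
  apply Rgt_not_eq, pow2_pos.
Qed.

Lemma lv_le1 u k : lv u k <= 1.
Proof. apply (lv_le u (fun _ _ => True)); [auto|]. rewrite lv_all; auto; lra. Qed.

Lemma lv_modular u v k :
  lv (fun k t => u k t \/ v k t) k + lv (fun k t => u k t /\ v k t) k = lv u k + lv v k.
Proof.
  unfold lv. pose proof (cnt_modular (2 ^ k) (u k) (v k)) as H. apply (f_equal INR) in H.
  rewrite !plus_INR in H. unfold Rdiv. rewrite <- !Rmult_plus_distr_r, H. reflexivity.
Qed.

Lemma lv_not u k : lv (fun k t => ~ u k t) k = 1 - lv u k.
Proof.
  pose proof (cnt_not (2 ^ k) (u k)) as H. apply (f_equal INR) in H.
  rewrite plus_INR, INR_pow2 in H. unfold lv. pose proof (pow2_pos k).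
  field_simplify_eq; lra.
Qed.

Lemma lv_S u k : mono u -> lv u k <= lv u (S k).
Proof.
  intro Hu. unfold lv. pose proof (pow2_pos k).
  pose proof (cnt_double (2 ^ k) (u k) (u (S k)) (fun t _ => Hu k t)) as H1.
  apply le_INR in H1. rewrite mult_INR in H1. simpl (INR 2) in H1.
  change (2 ^ S k)%nat with (2 * 2 ^ k)%nat.
  simpl (2 ^ S k). apply Rmult_le_reg_r with (2 * 2 ^ k); [lra|].
  unfold Rdiv. rewrite Rmult_assoc, (Rmult_assoc (INR _) (/ (2 * 2 ^ k))).
  rewrite Rinv_l by lra. replace (/ 2 ^ k * (2 * 2 ^ k)) with 2 by (field; lra). lra.
Qed.

Lemma lv_mono u k k' : mono u -> (k <= k')%nat -> lv u k <= lv u k'.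
Proof.
  intros Hu H. induction H; [lra|]. pose proof (lv_S u m Hu); lra.
Qed.

Lemma cov_ge0 A r : Cov A r -> 0 <= r.
Proof. intros (u & _ & _ & H). pose proof (lv_ge0 u 0); specialize (H 0%nat); lra. Qed.

Lemma mu_exists A : exists m, (forall r, Cov A r -> m <= r) /\ (forall r, m < r -> Cov A r).
Proof.
  destruct (completeness (fun r => Cov A (- r))) as [m [H1 H2]].
  - exists 0. intros r Hr. apply cov_ge0 in Hr; lra.
  - exists (-1). exists (fun _ _ => True). split; [repeat split|split].
    + intros x _; exists 0%nat; exact I.
    + intro k. pose proof (lv_le1 (fun _ _ => True) k); lra.
  - exists (- m); split.
    + intros r Hr. assert (- r <= m); [|lra]. apply H1. rewrite Ropp_involutive; exact Hr.
    + intros r Hr. apply NNPP; intro K. assert (m <= - r); [|lra]. apply H2.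
      intros s Hs. apply Rnot_lt_le; intro L. apply K.
      destruct Hs as (u & A1 & A2 & A3). exists u; split; [exact A1|split; [exact A2|]].
      intro k; specialize (A3 k); lra.
Qed.

Definition mu (A : real -> Prop) : R :=
  proj1_sig (constructive_indefinite_description _ (mu_exists A)).

Lemma mu_le_cov A r : Cov A r -> mu A <= r.
Proof. unfold mu; destruct constructive_indefinite_description; simpl; firstorder. Qed.

Lemma mu_cov A r : mu A < r -> Cov A r.
Proof. unfold mu; destruct constructive_indefinite_description; simpl; firstorder. Qed.

Lemma mu_mono (A B : real -> Prop) : (forall x, A x -> B x) -> mu A <= mu B.
Proof.
  intro H. apply Rnot_lt_le; intro L.
  destruct (mu_cov B ((mu A + mu B) / 2)) as (u & H1 & H2 & H3); [lra|].
  assert (mu A <= (mu A + mu B) / 2); [|lra].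
  apply mu_le_cov. exists u; split; [exact H1|split; [intros x Hx; auto|exact H3]].
Qed.

Lemma mu_ge0 A : 0 <= mu A.
Proof.
  apply Rnot_lt_le; intro L. destruct (mu_cov A (mu A / 2)) as (u & _ & _ & H); [lra|].
  pose proof (lv_ge0 u 0); specialize (H 0%nat); lra.
Qed.

Lemma mu_le1 A : mu A <= 1.
Proof.
  apply mu_le_cov. exists (fun _ _ => True). split; [repeat split|split].
  - intros x _; exists 0%nat; exact I.
  - apply lv_le1.
Qed.

Lemma mono_or u v : mono u -> mono v -> mono (fun k t => u k t \/ v k t).
Proof. intros Hu Hv k t [H|H]; [apply Hu in H|apply Hv in H]; tauto. Qed.

Lemma mono_and u v : mono u -> mono v -> mono (fun k t => u k t /\ v k t).
Proof. intros Hu Hv k t [H K]; apply Hu in H; apply Hv in K; tauto. Qed.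

Lemma mono_le u x k k' : mono u -> (k <= k')%nat -> u k (vb x k) -> u k' (vb x k').
Proof.
  intros Hu H Hk. induction H; [exact Hk|].
  apply Hu in IHle. rewrite vb_S. destruct (x m); [|rewrite Nat.add_0_r]; apply IHle.
Qed.

Lemma covers_and u v A B : mono u -> mono v -> covers u A -> covers v B ->
  covers (fun k t => u k t /\ v k t) (fun x => A x /\ B x).
Proof.
  intros Mu Mv Hu Hv x [Ha Hb]. destruct (Hu x Ha) as [k Hk]. destruct (Hv x Hb) as [k' Hk'].
  exists (Nat.max k k'). split; [apply (mono_le u x k) | apply (mono_le v x k')]; auto; lia.
Qed.

Lemma mu_union A B : mu (fun x => A x \/ B x) <= mu A + mu B.
Proof.
  apply Rnot_lt_le; intro L. set (e := (mu (fun x => A x \/ B x) - mu A - mu B) / 3).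
  destruct (mu_cov A (mu A + e)) as (u & H1 & H2 & H3); [unfold e; lra|].
  destruct (mu_cov B (mu B + e)) as (v & K1 & K2 & K3); [unfold e; lra|].
  assert (mu (fun x => A x \/ B x) <= mu A + mu B + 2 * e); [|unfold e in *; lra].
  apply mu_le_cov. exists (fun k t => u k t \/ v k t). split; [apply mono_or; auto|split].
  - intros x [Hx|Hx]; [destruct (H2 x Hx) as [k Hk]|destruct (K2 x Hx) as [k Hk]]; eauto.
  - intro k. pose proof (lv_modular u v k). pose proof (lv_ge0 (fun k t => u k t /\ v k t) k).
    specialize (H3 k); specialize (K3 k); lra.
Qed.

(* The union of covers [u i] of [A i] with excess [e / 2 ^ (i+1)] has excess less than [e] over [A n]: at each step the overlap of the new cover with the old ones still covers [A n]. *)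
Lemma mu_cont (A : nat -> real -> Prop) r :
  (forall n x, A n x -> A (S n) x) -> (forall n, mu (A n) <= r) ->
  mu (fun x => exists n, A n x) <= r.
Proof.
  intros Hinc Hr. apply Rnot_lt_le; intro L.
  set (e := (mu (fun x => exists n, A n x) - r) / 2). assert (He : 0 < e) by (unfold e; lra).
  assert (Hhalf : forall n, 0 < (/2) ^ n) by (intro; apply pow_lt; lra).
  assert (C : forall n, exists u, mono u /\ covers u (A n) /\ forall k, lv u k <= mu (A n) + e * (/2) ^ (S n)).
  { intro n. apply mu_cov. specialize (Hhalf (S n)). nra. }
  apply choice in C as [u Hu].
  set (v := fun n k t => exists i, (i <= n)%nat /\ u i k t).
  assert (Mv : forall n, mono (v n)).
  { intros n k t (i & Hi & H). apply Hu in H as [H H']. split; exists i; auto. }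
  assert (Cv : forall n, covers (v n) (A n)).
  { intros n x Hx. destruct (Hu n) as (_ & H & _). destruct (H x Hx) as [k Hk].
    exists k, n; auto. }
  assert (B : forall n k, lv (v n) k <= mu (A n) + e * (1 - (/2) ^ (S n))).
  { induction n as [|n IH]; intro k.
    - apply (lv_le _ (u 0%nat)).
      + intros t _ (i & Hi & H). replace i with 0%nat in H by lia; exact H.
      + destruct (Hu 0%nat) as (_ & _ & H). specialize (H k). simpl in H |- *. lra.
    - apply Rnot_lt_le; intro K.
      set (d := lv (v (S n)) k - (mu (A (S n)) + e * (1 - (/ 2) ^ S (S n)))) in *.
      destruct (Hu (S n)) as (M1 & C1 & H1).
      assert (D : exists k0, mu (A n) - d / 2 < lv (fun k t => v n k t /\ u (S n) k t) k0).
      { apply NNPP; intro N. assert (mu (A n) <= mu (A n) - d / 2); [|unfold d in *; lra].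
        apply mu_le_cov. exists (fun k t => v n k t /\ u (S n) k t).
        split; [apply mono_and; auto|split].
        - intros x Hx. apply (covers_and (v n) (u (S n)) (A n) (A (S n))); auto.
        - intro k0. apply Rnot_lt_le; intro; apply N; eauto. }
      destruct D as [k0 D].
      set (K0 := Nat.max k k0).
      pose proof (lv_mono _ k K0 (Mv (S n)) ltac:(lia)).
      pose proof (lv_mono _ k0 K0 (mono_and _ _ (Mv n) M1) ltac:(lia)).
      pose proof (lv_modular (v n) (u (S n)) K0).
      assert (lv (v (S n)) K0 <= lv (fun k t => v n k t \/ u (S n) k t) K0).
      { apply (lv_le _ (fun k t => v n k t \/ u (S n) k t)); [|lra].
        intros t _ (i & Hi & H'). destruct (Nat.eq_dec i (S n)) as [->|]; [auto|].
        left; exists i; split; [lia|exact H']. }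
      specialize (IH K0). specialize (H1 K0). simpl in *. unfold d in *. lra. }
  assert (mu (fun x => exists n, A n x) <= r + e); [|unfold e in *; lra].
  apply mu_le_cov. exists (fun k t => exists n, v n k t). split; [|split].
  - intros k t (n & H). apply Mv in H; split; exists n; tauto.
  - intros x (n & Hx). destruct (Cv n x Hx) as [k Hk]. exists k, n; exact Hk.
  - intro k.
    (* At a fixed level there are finitely many strings, so a single stage [M] contains all those
       that ever enter. *)
    assert (N : forall t, exists n, (exists n, v n k t) -> v n k t).
    { intro t. destruct (classic (exists n, v n k t)) as [[n Hn]|Hn]; [exists n; auto|].
      exists 0%nat; tauto. }
    apply choice in N as [N HN]. destruct (finite_bound N (2 ^ k)) as [M HM].
    apply (lv_le _ (v M)).
    + intros t Ht H. apply HN in H as (i & Hi & H). exists i; split; [|exact H].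
      specialize (HM t); lia.
    + specialize (B M k). specialize (Hr M). specialize (Hhalf (S M)). nra.
Qed.

(** Compactness: if no level of the cover were complete, [konig] would produce a real outside the
    cover. *)
Lemma mu_all : 1 <= mu (fun _ => True).
Proof.
  apply Rnot_lt_le; intro L.
  destruct (mu_cov (fun _ => True) ((mu (fun _ => True) + 1) / 2)) as (u & Mu & Cu & Hu); [lra|].
  assert (F : exists k, forall t, (t < 2 ^ k)%nat -> u k t).
  { apply NNPP; intro N.
    destruct (konig (fun _ => 1%nat) (fun k g => ~ u k (val g k))) as (g & _ & Hg).
    - intros k g g' E H. rewrite (val_ext g' g); [exact H|]. intros; rewrite E; auto.
    - intros k g H K. apply H. apply Mu in K.
      change (u (S k) (2 * val g k + sgn (g k))%nat).
      destruct (g k); cbn [sgn]; [rewrite Nat.add_0_r|]; apply K.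
    - intro k. apply NNPP; intro K. apply N. exists k. intros t Ht. apply NNPP; intro Hn.
      destruct (vb_surj k t Ht) as [x Hx]. apply K. exists (bn x). split.
      + intros; unfold bn; destruct (x i); lia.
      + unfold vb in Hx; rewrite Hx; exact Hn.
    - destruct (Cu (fun i => negb (g i =? 0)%nat) I) as [k Hk].
      apply (Hg k). replace (val g k) with (vb (fun i => negb (g i =? 0)%nat) k); [exact Hk|].
      apply val_ext. intros i _. unfold bn. destruct (g i); reflexivity. }
  destruct F as [k Hk]. specialize (Hu k). rewrite lv_all in Hu by exact Hk. lra.
Qed.

Lemma mu_compl B : 1 <= mu B + mu (fun x => ~ B x).
Proof.
  pose proof mu_all. pose proof (mu_union B (fun x => ~ B x)).
  assert (mu (fun _ => True) <= mu (fun x => B x \/ ~ B x)); [|lra].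
  apply mu_mono; intros; apply classic.
Qed.

(** Covers of [B] and of its complement together cover everything, so their overlap is small when
    the two outer measures add up to 1; they then split a cover of [C] almost without double
    counting. *)
Lemma mu_caratheodory (B C : real -> Prop) :
  mu B + mu (fun x => ~ B x) <= 1 ->
  mu (fun x => C x /\ B x) + mu (fun x => C x /\ ~ B x) <= mu C.
Proof.
  intro HB. apply Rnot_lt_le; intro L.
  (* The supposed excess is [5 * e]: the cover of [C] costs one [e], the overlap of [u] and [v] at
     most three. *)
  set (e := (mu (fun x => C x /\ B x) + mu (fun x => C x /\ ~ B x) - mu C) / 5).
  assert (He : 0 < e) by (unfold e; lra).
  destruct (mu_cov B (mu B + e)) as (u & H1 & H2 & H3); [lra|].
  destruct (mu_cov (fun x => ~ B x) (mu (fun x => ~ B x) + e)) as (v & K1 & K2 & K3); [lra|].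
  destruct (mu_cov C (mu C + e)) as (w & W1 & W2 & W3); [lra|].
  assert (D : exists k0, 1 - e < lv (fun k t => u k t \/ v k t) k0).
  { apply NNPP; intro N. pose proof mu_all.
    assert (mu (fun _ => True) <= 1 - e); [|lra].
    apply mu_le_cov. exists (fun k t => u k t \/ v k t). split; [apply mono_or; auto|split].
    - intros x _. destruct (classic (B x)) as [Hx|Hx];
        [destruct (H2 x Hx) as [k Hk]|destruct (K2 x Hx) as [k Hk]]; eauto.
    - intro k. apply Rnot_lt_le; intro; apply N; eauto. }
  destruct D as [k0 D].
  assert (E : mu (fun x => C x /\ B x) + mu (fun x => C x /\ ~ B x) <= mu C + 4 * e);
    [|unfold e in *; lra].
  apply Rnot_lt_le; intro L'.
  set (d := mu (fun x => C x /\ B x) + mu (fun x => C x /\ ~ B x) - (mu C + 4 * e)) in *.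
  assert (S1 : forall (z : nat -> nat -> Prop) (Z : real -> Prop), mono z -> covers z Z ->
    exists k, mu (fun x => C x /\ Z x) - d / 3 < lv (fun k t => w k t /\ z k t) k).
  { intros z Z Mz Cz. apply NNPP; intro N.
    assert (mu (fun x => C x /\ Z x) <= mu (fun x => C x /\ Z x) - d / 3); [|unfold d in *; lra].
    apply mu_le_cov. exists (fun k t => w k t /\ z k t). split; [apply mono_and; auto|split].
    - apply covers_and; auto.
    - intro k. apply Rnot_lt_le; intro; apply N; eauto. }
  destruct (S1 u B H1 H2) as [k1 D1]. destruct (S1 v (fun x => ~ B x) K1 K2) as [k2 D2].
  set (k := Nat.max k0 (Nat.max k1 k2)).
  pose proof (lv_mono _ k0 k (mono_or _ _ H1 K1) ltac:(lia)).
  pose proof (lv_mono _ k1 k (mono_and _ _ W1 H1) ltac:(lia)).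
  pose proof (lv_mono _ k2 k (mono_and _ _ W1 K1) ltac:(lia)).
  pose proof (lv_modular u v k).
  pose proof (lv_modular (fun k t => w k t /\ u k t) (fun k t => w k t /\ v k t) k).
  assert (lv (fun k t => w k t /\ u k t \/ w k t /\ v k t) k <= lv w k)
    by (apply (lv_le _ w); [tauto|lra]).
  assert (lv (fun k t => (w k t /\ u k t) /\ w k t /\ v k t) k <= lv (fun k t => u k t /\ v k t) k)
    by (apply (lv_le _ (fun k t => u k t /\ v k t)); [tauto|lra]).
  specialize (H3 k); specialize (K3 k); specialize (W3 k). unfold d in *. lra.
Qed.

(** * Clopen sets and countable subadditivity *)

Lemma cnt_halve N (P Q : nat -> Prop) :
  (forall t, Q (2 * t)%nat \/ Q (2 * t + 1)%nat -> P t) -> (cnt (2 * N) Q <= 2 * cnt N P)%nat.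
Proof.
  intro H. rewrite cnt_split.
  assert (cnt N (fun t => Q (2 * t)) <= cnt N P)%nat by (apply cnt_le; intros; apply H; auto).
  assert (cnt N (fun t => Q (2 * t + 1)) <= cnt N P)%nat by (apply cnt_le; intros; apply H; auto).
  lia.
Qed.

Lemma mu_clopen k (P : nat -> Prop) :
  mu (fun x => P (vb x k)) <= lv (fun _ => P) k.
Proof.
  (* [u] is empty below level [k], and its proportion does not grow after that level, so [lv u]
     nowhere exceeds its value at [k]. *)
  set (u := fun k' t => (k <= k')%nat /\ exists x, vb x k' = t /\ P (vb x k)).
  apply mu_le_cov. exists u. split; [|split].
  - intros k' t (Hk & x & Hx & HP).
    assert (E : forall b, u (S k') (2 * t + if b : bool then 1 else 0)%nat).
    { intro b. split; [lia|]. exists (fun i => if (i =? k')%nat then b else x i).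
      assert (Ex : forall j, (j <= k')%nat -> vb (fun i => if (i =? k')%nat then b else x i) j = vb x j).
      { intros j Hj. apply val_ext. intros i Hi. unfold bn. destruct (Nat.eqb_spec i k'); [lia|reflexivity]. }
      rewrite vb_S, Nat.eqb_refl, !Ex by lia. subst t; auto. }
    split; [rewrite <- (Nat.add_0_r (2 * t)); apply (E false)|apply (E true)].
  - intros x Hx. exists k. split; [lia|]. exists x; auto.
  - assert (H0 : forall k', (k' < k)%nat -> lv u k' <= lv u k).
    { intros k' Hk. apply (lv_le _ (fun _ _ => False)).
      - intros t _ (H & _); lia.
      - unfold lv at 1. rewrite cnt_none by auto. unfold Rdiv. rewrite Rmult_0_l. apply lv_ge0. }
    assert (H1 : forall d, lv u (k + d) <= lv u k).
    { induction d as [|d IH]; [rewrite Nat.add_0_r; lra|].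
      eapply Rle_trans; [|exact IH]. rewrite <- plus_n_Sm. unfold lv.
      set (j := (k + d)%nat). pose proof (pow2_pos j). change (2 ^ S j)%nat with (2 * 2 ^ j)%nat.
      assert (H' : (cnt (2 * 2 ^ j) (u (S j)) <= 2 * cnt (2 ^ j) (u j))%nat).
      { apply cnt_halve. intros t H'. split; [lia|].
        destruct H' as [(_ & x & Hx & HP)|(_ & x & Hx & HP)]; exists x; split; auto;
          rewrite vb_S in Hx; destruct (x j); lia. }
      apply le_INR in H'. rewrite mult_INR in H'. simpl in H' |- *.
      apply Rmult_le_reg_r with (2 * 2 ^ j); [lra|].
      unfold Rdiv. rewrite Rmult_assoc, (Rmult_assoc (INR _) (/ 2 ^ j)).
      rewrite Rinv_l by lra. replace (/ 2 ^ j * (2 * 2 ^ j)) with 2 by (field; lra). lra. }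
    assert (H2 : lv u k <= lv (fun _ => P) k).
    { apply (lv_le _ (fun _ => P)); [|lra]. intros t _ (_ & x & <- & H); exact H. }
    intro k'. destruct (Nat.lt_ge_cases k' k) as [H|H]; [specialize (H0 k' H); lra|].
    specialize (H1 (k' - k)%nat). replace (k + (k' - k))%nat with k' in H1 by lia. lra.
Qed.

Lemma cnt_eq_le1 N c : (cnt N (fun t => t = c) <= 1)%nat.
Proof.
  induction N as [|n IH]; simpl; [lia|].
  destruct (Nat.eq_dec n c) as [->|H]; [|rewrite ind_false by exact H; lia].
  rewrite cnt_none, ind_true; auto. intros; lia.
Qed.

Lemma mu_cylinder k t : mu (fun x => vb x k = t) <= (/ 2) ^ k.
Proof.
  eapply Rle_trans; [apply (mu_clopen k (fun s => s = t))|]. unfold lv.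
  pose proof (le_INR _ _ (cnt_eq_le1 (2 ^ k) t)) as H. simpl in H.
  rewrite pow_inv. unfold Rdiv. pose proof (Rinv_0_lt_compat _ (pow2_pos k)). nra.
Qed.

Lemma mu_null_subset (A B : real -> Prop) : (forall x, A x -> B x) -> mu B <= 0 -> mu A <= 0.
Proof. intros H HB. pose proof (mu_mono A B H); lra. Qed.

Lemma mu_false : mu (fun _ => False) <= 0.
Proof.
  apply mu_le_cov. exists (fun _ _ => False). split; [|split].
  - intros k t [].
  - intros x [].
  - intro k. unfold lv. rewrite cnt_none by auto. unfold Rdiv. simpl; lra.
Qed.

Lemma mu_pieces k (A : real -> Prop) (P : nat -> Prop) c :
  (forall t, P t -> mu (fun x => A x /\ vb x k = t) <= c) ->
  mu (fun x => A x /\ P (vb x k)) <= INR (cnt (2 ^ k) P) * c.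
Proof.
  intro H.
  assert (G : forall N, mu (fun x => A x /\ P (vb x k) /\ (vb x k < N)%nat) <= INR (cnt N P) * c).
  { induction N as [|n IH].
    - simpl. rewrite Rmult_0_l. apply (mu_null_subset _ (fun _ => False)); [|exact mu_false].
      intros x (_ & _ & Hx); lia.
    - simpl cnt. rewrite plus_INR.
      assert (E : mu (fun x => A x /\ P (vb x k) /\ (vb x k < S n)%nat) <=
        mu (fun x => A x /\ P (vb x k) /\ (vb x k < n)%nat) + mu (fun x => A x /\ vb x k = n /\ P n)).
      { eapply Rle_trans; [|apply mu_union]. apply mu_mono. intros x (Ha & Hp & Hx).
        destruct (Nat.eq_dec (vb x k) n) as [E|E]; [right; rewrite E in Hp; auto|left].
        repeat split; auto; lia. }
      assert (E' : mu (fun x => A x /\ vb x k = n /\ P n) <= INR (ind (P n)) * c).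
      { destruct (classic (P n)) as [p|p].
        - rewrite ind_true by exact p. simpl. rewrite Rmult_1_l.
          eapply Rle_trans; [|apply (H n p)]. apply mu_mono; tauto.
        - rewrite ind_false by exact p. simpl. rewrite Rmult_0_l.
          apply (mu_null_subset _ (fun _ => False)); [tauto|exact mu_false]. }
      lra. }
  eapply Rle_trans; [|apply G]. apply mu_mono. intros x [Ha Hp]. repeat split; auto. apply val_lt.
Qed.

Lemma mu_sigma (A : nat -> real -> Prop) a s :
  (forall n, mu (A n) <= a n) -> (forall n, sum_f_R0 a n <= s) ->
  mu (fun x => exists n, A n x) <= s.
Proof.
  intros HA Hs.
  assert (H : mu (fun x => exists n i, (i <= n)%nat /\ A i x) <= s).
  { apply (mu_cont (fun n x => exists i, (i <= n)%nat /\ A i x)).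
    - intros n x (i & Hi & Hx). exists i; auto.
    - intro n. eapply Rle_trans; [|apply (Hs n)]. induction n as [|n IH]; simpl.
      + eapply Rle_trans; [|apply HA]. apply mu_mono. intros x (i & Hi & Hx).
        replace 0%nat with i by lia; exact Hx.
      + eapply Rle_trans; [|apply Rplus_le_compat; [apply IH|apply HA]].
        eapply Rle_trans; [|apply mu_union]. apply mu_mono. intros x (i & Hi & Hx).
        destruct (Nat.eq_dec i (S n)) as [->|]; [auto|left; exists i; split; [lia|exact Hx]]. }
  eapply Rle_trans; [|exact H]. apply mu_mono. intros x [n Hn]. exists n, n; auto.
Qed.

Lemma mu_null_union (A : nat -> real -> Prop) :
  (forall n, mu (A n) <= 0) -> mu (fun x => exists n, A n x) <= 0.
Proof.
  intro H. apply (mu_sigma A (fun _ => 0)); [exact H|].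
  induction n; simpl; lra.
Qed.

(** * Measure of [Sigma11] sets *)

Lemma con_sgn ox ox' a b m j : sgn ox = sgn ox' -> con ox a b m j -> con ox' a b m j.
Proof.
  intros E. assert (H : ox = 0%nat <-> ox' = 0%nat) by (destruct ox, ox'; simpl in E; split; congruence).
  unfold con, conb. rewrite H. tauto.
Qed.

Definition Ap (o w : nat -> nat) (m k : nat) : Prop :=
  ((m < k)%nat -> ~ w m = 0%nat) /\
  forall i j, (i < k)%nat -> (j < k)%nat -> con (o j) (w i) (w j) i j.

Lemma Ap_ext o o' w w' m k :
  (forall i, (i < k)%nat -> sgn (o i) = sgn (o' i)) -> (forall i, (i < k)%nat -> w i = w' i) ->
  Ap o w m k -> Ap o' w' m k.
Proof.
  intros Ho Hw [H1 H2]. split.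
  - intro; rewrite <- Hw by assumption; auto.
  - intros i j Hi Hj. rewrite <- !Hw by assumption. apply (con_sgn (o j)); auto.
Qed.

Lemma Ap_le o w m k k' : (k <= k')%nat -> Ap o w m k' -> Ap o w m k.
Proof.
  intros H [H1 H2]; split; [intro; apply H1; lia | intros; apply H2; lia].
Qed.

Lemma U_Ap o m : U o m <-> exists w, forall k, Ap o w m k.
Proof.
  split.
  - intros (w & H1 & H2). exists w; intro k; split; auto.
  - intros (w & H). exists w; split.
    + apply (H (S m)); lia.
    + intros i j. apply (H (S (i + j))); lia.
Qed.

(* [Kap h m] is the compact set of the [x] for which the constraints have a solution bounded by [h]; [Kap h m k t] is its approximation at level [k]. *)
Definition Kap (h : nat -> nat) (m k t : nat) : Prop :=
  exists o w : nat -> nat, val o k = t /\ (forall i, (i < k)%nat -> (w i <= h i)%nat) /\ Ap o w m k.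

Lemma Kap_compact h m x : (forall k, Kap h m k (vb x k)) -> U (bn x) m.
Proof.
  intro H.
  destruct (konig h (fun k w => Ap (bn x) w m k)) as (w & _ & Hw).
  - intros k g g' E. apply Ap_ext; auto.
  - intros k g. apply Ap_le; lia.
  - intro k. destruct (H k) as (o & w & H1 & H2 & H3). exists w; split; [exact H2|].
    apply (Ap_ext o _ w); auto. apply val_inj; exact H1.
  - apply U_Ap; exists w; exact Hw.
Qed.

Lemma mono_not_Kap h m : mono (fun k t => ~ Kap h m k t).
Proof.
  assert (E : forall k t b, (b <= 1)%nat -> Kap h m (S k) (2 * t + b) -> Kap h m k t).
  { intros k t b Hb (o & w & H1 & H2 & H3). exists o, w. split; [|split].
    - simpl in H1. pose proof (sgn_le (o k)). lia.
    - auto.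
    - apply (Ap_le _ _ _ k (S k)); auto. }
  intros k t H; split; intro K; apply H.
  - apply (E k t 0%nat); [lia|]. rewrite Nat.add_0_r; exact K.
  - apply (E k t 1%nat); [lia|exact K].
Qed.

(** By [Kap_compact], an [x] outside the set leaves [Kap] at some level, so the complements of the
    levels form an open cover. *)
Lemma Kap_outer h m r : (forall k, r <= lv (Kap h m) k) -> mu (fun x => ~ U (bn x) m) <= 1 - r.
Proof.
  intro H. apply mu_le_cov. exists (fun k t => ~ Kap h m k t). split; [|split].
  - apply mono_not_Kap.
  - intros x Hx. apply NNPP; intro N. apply Hx, (Kap_compact h). intro k.
    apply NNPP; intro K; apply N; eauto.
  - intro k. rewrite lv_not. specialize (H k); lra.
Qed.

(** Capacitability of analytic sets: the bounds [h 0], [h 1], ... are chosen in turn. With the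
    earlier ones fixed, the sets belonging to [v = 0, 1, ...] increase to all that is left, so by
    [mu_cont] some [v] keeps the outer measure above [r]. *)
Lemma capacity m r : r < mu (fun x => U (bn x) m) -> exists h, forall k, r <= lv (Kap h m) k.
Proof.
  intro Hr.
  set (Q := fun k (h : nat -> nat) (x : real) => exists w : nat -> nat,
    (forall k, Ap (bn x) w m k) /\ forall i, (i < k)%nat -> (w i <= h i)%nat).
  destruct (dependent_build (fun k h => r < mu (Q k h))) as [h Hh].
  - intros k g g' E H. eapply Rlt_le_trans; [exact H|]. apply mu_mono.
    intros x (w & H1 & H2). exists w; split; [exact H1|]. intros i Hi. rewrite <- E; auto.
  - eapply Rlt_le_trans; [exact Hr|]. apply mu_mono. intros x Hx. apply U_Ap in Hx as [w Hw].
    exists w; split; [exact Hw|lia].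
  - intros k h Hh. apply NNPP; intro N.
    assert (mu (fun x => exists v, Q (S k) (upd h k v) x) <= r).
    { apply mu_cont.
      - intros v x (w & H1 & H2). exists w; split; [exact H1|]. intros i Hi. specialize (H2 i Hi).
        unfold upd in *; destruct (i =? k)%nat; lia.
      - intro v. apply Rnot_lt_le; intro; apply N; eauto. }
    assert (mu (Q k h) <= mu (fun x => exists v, Q (S k) (upd h k v) x)); [|lra].
    apply mu_mono. intros x (w & H1 & H2). exists (w k), w; split; [exact H1|].
    intros i Hi. destruct (Nat.eq_dec i k) as [->|]; [rewrite upd_same; lia|].
    rewrite upd_lt by lia. apply H2; lia.
  - exists h; intro k.
    eapply Rle_trans; [left; apply (Hh k)|].
    eapply Rle_trans; [|apply (mu_clopen k (Kap h m k))].
    apply mu_mono. intros x (w & H1 & H2). exists (bn x), w; auto.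
Qed.

(** If the sum exceeded 1, a compact subset of measure at least [r], midway between 1 minus the
    outer measure of the complement and that of the set, would leave the complement too little
    room. *)
Lemma mu_U_measurable m : mu (fun x => U (bn x) m) + mu (fun x => ~ U (bn x) m) <= 1.
Proof.
  apply Rnot_lt_le; intro L.
  destruct (capacity m (1 - mu (fun x => ~ U (bn x) m) + (mu (fun x => U (bn x) m) - (1 - mu (fun x => ~ U (bn x) m))) / 2))
    as [h Hh]; [lra|].
  apply Kap_outer in Hh. lra.
Qed.

(** The larger fraction [a' / b'] leaves room, so that the levels of the compact set need only
    satisfy a weak inequality; [Z] lists [N] strings of a level. *)
Definition MuGt (m a b : nat) : Prop :=
  exists a' b', (a * b' < a' * b)%nat /\ exists h : nat -> nat, forall k,
  exists N, (a' * 2 ^ k <= b' * N)%nat /\ exists Z : nat -> nat, forall i, (i < N)%nat ->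
    (Z i < 2 ^ k)%nat /\ Kap h m k (Z i) /\ forall j, (j < i)%nat -> ~ Z j = Z i.

Lemma rational_between x y : 0 <= x < y ->
  exists a b, (0 < b)%nat /\ x < INR a / INR b < y.
Proof.
  intros [Hx Hxy].
  destruct (archimed_cor1 (y - x)) as (b & Hb & Hb'); [lra|].
  assert (B : 0 < INR b) by (apply lt_0_INR; lia).
  pose proof (archimed (x * INR b)) as [A1 A2].
  assert (A3 : (0 <= up (x * INR b))%Z) by (apply le_IZR; nra).
  exists (Z.to_nat (up (x * INR b))), b. split; [lia|].
  rewrite INR_IZR_INZ, Z2Nat.id by exact A3.
  assert (B' : 1 < (y - x) * INR b).
  { apply Rmult_lt_reg_l with (/ INR b); [apply Rinv_0_lt_compat, B|]. field_simplify; lra. }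
  split; apply Rmult_lt_reg_r with (INR b); try exact B; unfold Rdiv;
    rewrite ?Rmult_assoc, ?Rinv_l by lra; lra.
Qed.

Lemma frac_lt a b c d : (0 < b)%nat -> (0 < d)%nat ->
  (INR a / INR b < INR c / INR d <-> (a * d < c * b)%nat).
Proof.
  intros Hb Hd. apply lt_INR in Hb, Hd. simpl in Hb, Hd.
  assert (E : INR a / INR b < INR c / INR d <-> INR (a * d) < INR (c * b)).
  { rewrite !mult_INR. split; intro H.
    - apply Rmult_lt_compat_r with (r := INR b * INR d) in H; [|nra].
      field_simplify in H; lra.
    - apply Rmult_lt_reg_r with (INR b * INR d); [nra|]. field_simplify; lra. }
  rewrite E. split; [apply INR_lt|apply lt_INR].
Qed.

Lemma MuGt_spec m a b : (0 < b)%nat -> (MuGt m a b <-> INR a / INR b < mu (fun x => U (bn x) m)).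
Proof.
  intro Hb. assert (B : 0 < INR b) by (apply lt_0_INR, Hb). split.
  - intros (a' & b' & H & h & Hh).
    assert (Hb' : (0 < b')%nat).
    { destruct b'; [|lia]. destruct (Hh 0%nat) as (N & HN & _). simpl in HN. nia. }
    assert (B' : 0 < INR b') by (apply lt_0_INR, Hb').
    assert (K : forall k, INR a' / INR b' <= lv (Kap h m) k).
    { intro k. destruct (Hh k) as (N & HN & HZ).
      apply (cnt_ge N (2 ^ k) (Kap h m k)) in HZ.
      assert (HN' : (a' * 2 ^ k <= b' * cnt (2 ^ k) (Kap h m k))%nat) by nia.
      apply le_INR in HN'. rewrite !mult_INR, INR_pow2 in HN'. unfold lv.
      pose proof (pow2_pos k). apply Rmult_le_reg_r with (INR b' * 2 ^ k); [nra|].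
      field_simplify; lra. }
    apply Kap_outer in K. pose proof (mu_compl (fun x => U (bn x) m)).
    apply (frac_lt a b a' b' Hb Hb') in H. lra.
  - intro H.
    assert (A : 0 <= INR a / INR b).
    { apply Rmult_le_pos; [apply pos_INR|left; apply Rinv_0_lt_compat, B]. }
    destruct (rational_between _ _ (conj A H)) as (a' & b' & Hb' & H1 & H2).
    exists a', b'. split; [apply frac_lt; assumption|].
    destruct (capacity _ _ H2) as [h Hh]. exists h. intro k. exists (cnt (2 ^ k) (Kap h m k)).
    split.
    + apply INR_le. rewrite !mult_INR, INR_pow2. specialize (Hh k). unfold lv in Hh.
      assert (B' : 0 < INR b') by (apply lt_0_INR, Hb').
      pose proof (pow2_pos k). apply Rmult_le_compat_r with (r := INR b' * 2 ^ k) in Hh; [|nra].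
      field_simplify in Hh; lra.
    + apply (cnt_ge _ (2 ^ k) (Kap h m k)); lia.
Qed.

Lemma sg_Kap h m k t :
  FnF h -> Fn m -> Fn k -> Fn t -> Sg (fun g => Kap (h g) (m g) (k g) (t g)).
Proof. intros; unfold Kap, Ap; sg. Qed.

Ltac sg_hook_more ::= lazymatch goal with
  | |- Sg (fun g => Kap _ _ _ _) => apply sg_Kap
  end.

Lemma sg_MuGt m a b : Fn m -> Fn a -> Fn b -> Sg (fun g => MuGt (m g) (a g) (b g)).
Proof. intros; unfold MuGt; sg. Qed.

(** * Comparison of well-founded trees *)

Local Open Scope nat_scope.

(** Comparison of ranks without ordinals: when [S2] is well-founded below [b], a simulation exists
    exactly if the rank of [a] is at most that of [b]. The relation is coded as the zero set of a
    function, which makes the notion Sigma11. *)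
Definition Sim (S1 S2 : nat -> nat -> Prop) (a b : nat) : Prop :=
  exists R : nat -> nat, R (pair a b) = 0 /\ forall p p', R (pair p p') = 0 ->
    forall q, S1 p q -> exists q', S2 p' q' /\ R (pair q q') = 0.

Definition Wf (S1 : nat -> nat -> Prop) (a : nat) : Prop := Acc (fun q p => S1 p q) a.

Lemma sim_elim S1 S2 a b q : Sim S1 S2 a b -> S1 a q -> exists q', S2 b q' /\ Sim S1 S2 q q'.
Proof.
  intros (R & H0 & H) Hq. destruct (H _ _ H0 q Hq) as (q' & H1 & H2).
  exists q'; split; [exact H1|]. exists R; auto.
Qed.

(** Adding the pair of [a] and [b] to the largest simulation, which is [Sim] itself, gives a
    simulation. *)
Lemma sim_intro S1 S2 a b :
  (forall q, S1 a q -> exists q', S2 b q' /\ Sim S1 S2 q q') -> Sim S1 S2 a b.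
Proof.
  intro H.
  exists (fun n => if excluded_middle_informative ((p1 n = a /\ p2 n = b) \/ Sim S1 S2 (p1 n) (p2 n))
    then 0 else 1).
  split.
  - destruct excluded_middle_informative as [_|N]; [reflexivity|].
    rewrite p1_pair, p2_pair in N; tauto.
  - intros p p'. rewrite p1_pair, p2_pair.
    destruct excluded_middle_informative as [K|K]; [intros _|discriminate].
    intros q Hq.
    assert (exists q', S2 p' q' /\ Sim S1 S2 q q') as (q' & H1 & H2).
    { destruct K as [[-> ->]|K]; [apply H, Hq|apply (sim_elim _ _ p); assumption]. }
    exists q'; split; [exact H1|]. rewrite p1_pair, p2_pair.
    destruct excluded_middle_informative; tauto.
Qed.

Lemma sim_wf S1 S2 b : Wf S2 b -> forall a, Sim S1 S2 a b -> Wf S1 a.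
Proof.
  induction 1 as [b _ IH]; intros a Ha. constructor. intros q Hq.
  destruct (sim_elim _ _ _ _ _ Ha Hq) as (q' & H1 & H2). apply (IH q'); assumption.
Qed.

(** The second alternative means that the rank of [b] is smaller than that of [a], an ill-founded
    [a] counting as having infinite rank. *)
Lemma sim_total S1 S2 b : Wf S2 b -> forall a,
  Sim S1 S2 a b \/ exists q, S1 a q /\ Sim S2 S1 b q.
Proof.
  induction 1 as [b _ IH]; intros a.
  destruct (classic (Sim S1 S2 a b)) as [H|H]; [auto|right].
  apply NNPP; intro N. apply H, sim_intro. intros q Hq.
  apply NNPP; intro K. apply N. exists q; split; [exact Hq|].
  apply sim_intro. intros q' Hq'. destruct (IH q' Hq' q) as [L|L]; [|exact L].
  exfalso; apply K; eauto.
Qed.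

Lemma sim_strict S1 S2 b : Wf S2 b -> forall a q,
  Sim S1 S2 a b -> S1 a q -> ~ Sim S2 S1 b q.
Proof.
  induction 1 as [b _ IH]; intros a q Ha Hq K.
  destruct (sim_elim _ _ _ _ _ Ha Hq) as (q' & H1 & H2).
  destruct (sim_elim _ _ _ _ _ K H1) as (q'' & H3 & H4).
  exact (IH q' H1 q q'' H2 H3 H4).
Qed.

(* Nodes [pair k c] of the tree of attempts at solving the constraints of [U o m]: the sequence [dec c 0, ..., dec c (k-1)]. [Step] is proper extension to a valid node. *)
Definition Step (o : nat -> nat) (m p q : nat) : Prop :=
  p1 p < p1 q /\ (forall i, i < p1 p -> dec (p2 q) i = dec (p2 p) i) /\
  Ap o (dec (p2 q)) m (p1 q).

Lemma U_not_wf o m : U o m -> ~ Wf (Step o m) 0.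
Proof.
  rewrite U_Ap. intros [w Hw] H.
  assert (K : forall n, Wf (Step o m) n -> (forall i, i < p1 n -> dec (p2 n) i = w i) -> False).
  { induction 1 as [n _ IH]; intro Hn.
    destruct (dec_surj w (S (p1 n))) as [c Hc].
    apply (IH (pair (S (p1 n)) c)).
    - unfold Step. rewrite p1_pair, p2_pair. split; [lia|split].
      + intros i Hi. rewrite Hn, Hc by lia; reflexivity.
      + apply (Ap_ext o o w); auto. intros; symmetry; auto.
    - rewrite p1_pair, p2_pair. exact Hc. }
  (* [0] is [pair 0 0], the empty sequence, which agrees with every [w]. *)
  apply (K 0 H). intros i Hi. change (p1 0) with 0 in Hi. lia.
Qed.

(** Along an infinite branch the lengths grow strictly, so entry [i] of the solution is settled from
    node [s (S i)] on. *)
Lemma not_wf_U o m : ~ Wf (Step o m) 0 -> U o m.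
Proof.
  intro H0.
  assert (C : forall n, exists q, ~ Wf (Step o m) n -> Step o m n q /\ ~ Wf (Step o m) q).
  { intro n. destruct (classic (exists q, Step o m n q /\ ~ Wf (Step o m) q)) as [[q Hq]|N].
    - exists q; auto.
    - exists 0. intro K. exfalso; apply K. constructor. intros q Hq. apply NNPP; intro L; apply N; eauto. }
  apply choice in C as [f Hf].
  set (s := fix s k := match k with O => 0 | S k => f (s k) end).
  assert (Hs : forall k, ~ Wf (Step o m) (s k)) by (induction k; [exact H0|apply Hf; assumption]).
  assert (HS : forall k, Step o m (s k) (s (S k))) by (intro k; apply Hf, Hs).
  assert (Hlen : forall k, k <= p1 (s k)).
  { induction k as [|k IH]; [lia|]. destruct (HS k) as [H _]; lia. }
  assert (Hst : forall d k i, i < p1 (s k) -> dec (p2 (s (d + k))) i = dec (p2 (s k)) i).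
  { induction d as [|d IH]; intros k i Hi; [reflexivity|].
    rewrite <- (IH k i Hi). destruct (HS (d + k)) as (_ & H & _). apply H.
    clear - Hi HS. induction d as [|d IH]; [exact Hi|]. destruct (HS (d + k)) as [H _]. simpl Nat.add. lia. }
  apply U_Ap. exists (fun i => dec (p2 (s (S i))) i). intro k.
  apply (Ap_ext o o (dec (p2 (s (S k)))) _); [reflexivity| |].
  - intros i Hi. replace (S k) with ((k - i) + S i) by lia. apply Hst.
    specialize (Hlen (S i)); lia.
  - destruct (HS k) as (_ & _ & H). apply (Ap_le _ _ _ k (p1 (s (S k)))); [|exact H].
    specialize (Hlen (S k)); lia.
Qed.

Lemma wf_U o m : Wf (Step o m) 0 <-> ~ U o m.
Proof.
  split.
  - intros H K. exact (U_not_wf o m K H).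
  - intro H. apply NNPP; intro K. apply H, not_wf_U, K.
Qed.

Definition LE (o : nat -> nat) (m : nat) (o' : nat -> nat) (m' : nat) : Prop :=
  Sim (Step o m) (Step o' m') 0 0.

Definition LT (o : nat -> nat) (m : nat) (o' : nat -> nat) (m' : nat) : Prop :=
  exists q, Step o' m' 0 q /\ Sim (Step o m) (Step o' m') 0 q.

Lemma LE_wf o m o' m' : LE o m o' m' -> ~ U o' m' -> ~ U o m.
Proof. intros H. rewrite <- !wf_U. intro K. exact (sim_wf _ _ _ K _ H). Qed.

Lemma LT_wf o m o' m' : LT o m o' m' -> ~ U o' m' -> ~ U o m.
Proof.
  intros (q & Hq & H). rewrite <- !wf_U. intro K. refine (sim_wf _ _ q _ _ H).
  destruct K as [K]; apply K, Hq.
Qed.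

(** Against a fixed well-founded tree, [LE] has a Sigma11 complement, the strict comparison in the
    other direction; hence it is a Delta11 condition. *)
Lemma not_LE o m o' m' : ~ U o' m' -> (~ LE o m o' m' <-> LT o' m' o m).
Proof.
  rewrite <- wf_U. intro K. split.
  - intro H. destruct (sim_total (Step o m) _ _ K 0) as [L|L]; [contradiction|exact L].
  - intros (q & Hq & H) L. exact (sim_strict _ _ _ K _ _ L Hq H).
Qed.

Lemma sg_U_def o m : FnF o -> Fn m -> Sg (fun g => U (o g) (m g)).
Proof. intros; unfold U; sg. Qed.

Lemma sg_LE o m o' m' : FnF o -> Fn m -> FnF o' -> Fn m' ->
  Sg (fun g => LE (o g) (m g) (o' g) (m' g)).
Proof. intros; unfold LE, Sim, Step, Ap; sg. Qed.

Lemma sg_LT o m o' m' : FnF o -> Fn m -> FnF o' -> Fn m' ->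
  Sg (fun g => LT (o g) (m g) (o' g) (m' g)).
Proof. intros; unfold LT, Sim, Step, Ap; sg. Qed.

Definition zo : nat -> nat := fun _ => 0.

Lemma fnF_zo : FnF (fun _ => zo).
Proof. unfold FnF, zo; sg. Qed.

Lemma fn_arg q n : Fn q -> Fn n -> Fn (fun g => arg (q g) (n g)).
Proof. intros; unfold arg; sg. Qed.

Ltac sg_hook_more ::= lazymatch goal with
  | |- FnF (fun g => zo) => apply fnF_zo
  | |- Fn (fun g => arg _ _) => apply fn_arg
  | |- Sg (fun g => MuGt _ _ _) => apply sg_MuGt
  | |- Sg (fun g => U _ _) => apply sg_U_def
  | |- Sg (fun g => LE _ _ _ _) => apply sg_LE
  | |- Sg (fun g => LT _ _ _ _) => apply sg_LT
  end.

(** * A set not [Sigma11] in almost every real *)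

Definition W (m : nat) : Prop := ~ U zo (arg m m).

(** Diagonalization at the index [q] of the supposed definition. *)
Lemma W_not_Sigma11 P : Sg P -> ~ forall n, W n <-> P (at_ zo n).
Proof.
  intros HP H. destruct (sg_U P HP) as [q Hq].
  specialize (H q). specialize (Hq (fun _ => false) q). change (bn (fun _ => false)) with zo in Hq.
  rewrite Hq in H. unfold W in H. tauto.
Qed.

Local Open Scope R_scope.

Lemma mu_density (A : real -> Prop) : 0 < mu A ->
  exists k t, 3 / 4 * (/ 2) ^ k < mu (fun x => A x /\ vb x k = t).
Proof.
  intro HA. apply NNPP; intro N.
  (* A cover of measure at most 5/4 of [mu A], filled by [A] to at most 3/4 in each cylinder, would
     bound [mu A] by 15/16 of itself. *)
  destruct (mu_cov A (5 / 4 * mu A)) as (u & Mu & Cu & Hu); [lra|].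
  assert (H : mu (fun x => exists k, A x /\ u k (vb x k)) <= 15 / 16 * mu A).
  { apply (mu_cont (fun k x => A x /\ u k (vb x k))).
    - intros k x [Hx Hk]; split; [exact Hx|]. apply (mono_le u x k); auto.
    - intro k. eapply Rle_trans; [apply (mu_pieces k A (u k) (3 / 4 * (/ 2) ^ k))|].
      + intros t _. apply Rnot_lt_le; intro; apply N; eauto.
      + specialize (Hu k). unfold lv in Hu. rewrite pow_inv. unfold Rdiv in *. lra. }
  assert (mu A <= mu (fun x => exists k, A x /\ u k (vb x k))); [|lra].
  apply mu_mono. intros x Hx. destruct (Cu x Hx) as [k Hk]; eauto.
Qed.

Lemma mu_Sigma11_W : mu (fun x => exists q, forall n, W n <-> U (bn x) (arg q n)) <= 0.
Proof.
  apply mu_null_union. intro q. apply Rnot_lt_le; intro L.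
  destruct (mu_density _ L) as (k & t & D). clear L.
  set (A := fun x => (forall n, W n <-> U (bn x) (arg q n)) /\ vb x k = t) in D.
  destruct (sg_U (fun g => val (hdF g) k = t /\ U (hdF g) (arg q (hd g)))) as [q' Hq']; [sg|].
  unfold at_, hdF, hd in Hq'; simpl in Hq'. fold vb in Hq'.
  assert (HE : forall n, mu (fun x => U (bn x) (arg q' n)) = mu (fun x => vb x k = t /\ U (bn x) (arg q n))).
  { intro n. apply Rle_antisym; apply mu_mono; intros x; rewrite <- Hq'; auto. }
  assert (B : (0 < 2 ^ S k)%nat) by (apply Nat.neq_0_lt_0, Nat.pow_nonzero; lia).
  (* The threshold is half the measure of the cylinder. For [n] in [W] the set to be measured
     contains [A], which has more than 3/4; for [n] outside, [A] lies in its complement, and 1/2 and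
     3/4 do not fit into one cylinder. *)
  assert (E : INR 1 / INR (2 ^ S k) = 1 / 2 * (/ 2) ^ k).
  { rewrite INR_pow2, pow_inv. simpl. field. apply Rgt_not_eq, pow2_pos. }
  assert (P : 0 < (/ 2) ^ k) by (apply pow_lt; lra).
  apply (W_not_Sigma11 (fun g => MuGt (arg q' (hd g)) 1 (2 ^ S k))); [sg|].
  intro n. unfold at_, hd; simpl nv. unfold scons.
  rewrite (MuGt_spec _ _ _ B), E, HE. split.
  - intro HW. assert (mu A <= mu (fun x => vb x k = t /\ U (bn x) (arg q n))); [|lra].
    apply mu_mono. intros x [H1 H2]. split; [exact H2|]. apply H1, HW.
  - intro H. apply NNPP; intro HW.
    pose proof (mu_caratheodory (fun x => U (bn x) (arg q' n)) (fun x => vb x k = t) (mu_U_measurable _)) as C.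
    pose proof (mu_cylinder k t).
    assert (mu (fun x => vb x k = t /\ U (bn x) (arg q n)) <= mu (fun x => vb x k = t /\ U (bn x) (arg q' n))).
    { apply mu_mono. intros x [H1 H2]. split; [exact H1|]. apply Hq'; auto. }
    assert (mu A <= mu (fun x => vb x k = t /\ ~ U (bn x) (arg q' n))); [|lra].
    apply mu_mono. intros x [K1 K2]. split; [exact K2|]. rewrite <- Hq', <- K1. tauto.
Qed.

(* The ranks of the trees refuting [y n = false] are bounded by that of a well-founded tree without oracle: otherwise [W] would consist of the [m] whose tree is smaller than one of them, hence be [Sigma11] in [x]. *)
Lemma hyp_le_LE x y :
  ~ (exists q, forall n, W n <-> U (bn x) (arg q n)) -> hyp_le y x ->
  exists q m, W m /\ forall n, y n = true <-> LE (bn x) (arg q n) zo (arg m m).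
Proof.
  intros Hx [[phi Hphi] [psi Hpsi]].
  destruct (Sigma11_U phi) as [r Hr]. destruct (Sigma11_U psi) as [q Hq].
  assert (H1 : forall n, y n = true <-> U (bn x) (arg r n)) by (intro; rewrite Hphi; apply Hr).
  assert (H0 : forall n, y n <> true <-> U (bn x) (arg q n)) by (intro; rewrite Hpsi; apply Hq).
  clear phi psi Hphi Hpsi Hr Hq.
  assert (E : exists m, W m /\ forall n, y n = true -> LE (bn x) (arg q n) zo (arg m m)).
  { apply NNPP; intro N. apply Hx.
    destruct (sg_U (fun g => exists n, U (hdF g) (arg r n) /\
      LT zo (arg (hd g) (hd g)) (hdF g) (arg q n))) as [s Hs]; [sg|].
    unfold at_, hdF, hd in Hs; simpl in Hs.
    exists s; intro m. rewrite <- Hs. split.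
    - intro HW. apply NNPP; intro K. apply N. exists m; split; [exact HW|].
      intros n Hn. apply NNPP; intro L. apply K. exists n. split; [apply H1, Hn|].
      apply (not_LE _ _ _ _ HW), L.
    - intros (n & Hn & L). apply (LT_wf _ _ _ _ L). rewrite <- H0. rewrite <- H1 in Hn. tauto. }
  destruct E as (m & HW & E). exists q, m. split; [exact HW|]. intro n; split; [apply E|].
  intro L. pose proof (LE_wf _ _ _ _ L HW) as K. rewrite <- H0 in K. tauto.
Qed.

(** * Hyperarithmetic maps and their distribution *)

Definition DeltaMap (f : real -> real) : Prop :=
  exists q1 q0, forall x n,
    (f x n = true <-> U (bn x) (arg q1 n)) /\ (f x n = false <-> U (bn x) (arg q0 n)).

(** The value [f x] is guessed as [F], which the two indices determine completely; a Sigma11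
    condition on an initial segment of [f x] is therefore Sigma11 in [x]. *)
Lemma DeltaMap_code f (P : nat -> nat -> nat -> Prop) : DeltaMap f ->
  (forall (v n j : ctx -> nat), Fn v -> Fn n -> Fn j -> Sg (fun g => P (v g) (n g) (j g))) ->
  exists q, forall x n j, P (vb (f x) n) n j <-> U (bn x) (arg q (pair n j)).
Proof.
  intros (q1 & q0 & Hf) HP.
  destruct (sg_U (fun g => exists F : nat -> nat,
    (forall i, (F i = 1%nat /\ U (hdF g) (arg q1 i)) \/ (F i = 0%nat /\ U (hdF g) (arg q0 i))) /\
    P (val F (p1 (hd g))) (p1 (hd g)) (p2 (hd g)))) as [q Hq].
  { apply sg_exF, sg_and; [sg|]. apply HP; sg. }
  exists q. intros x n j. rewrite <- Hq. unfold at_, hdF, hd; simpl. rewrite p1_pair, p2_pair. split.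
  - intro H. exists (bn (f x)). split; [|exact H].
    intro i. unfold bn at 1 3. destruct (f x i) eqn:E; [left|right]; split; auto; apply Hf, E.
  - intros (F & HF & H). unfold vb. replace (bn (f x)) with F; [exact H|].
    apply functional_extensionality; intro i. unfold bn.
    destruct (HF i) as [[-> K]|[-> K]]; apply Hf in K; rewrite K; reflexivity.
Qed.

Definition V (f : real -> real) (n j : nat) : R := mu (fun x => (vb (f x) n < j)%nat).
Definition D (f : real -> real) (n j : nat) : R := mu (fun x => vb (f x) n = j).

(* The distribution function of the image measure, [vl f y] being the measure of [{x | f x < y}] for the lexicographic order. *)
Definition vl (f : real -> real) (y : real) : R :=
  mu (fun x => exists n, (vb (f x) n < vb y n)%nat).

Lemma mu_ext (A B : real -> Prop) : (forall x, A x <-> B x) -> mu A = mu B.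
Proof. intro H; apply Rle_antisym; apply mu_mono; intros; apply H; assumption. Qed.

Lemma frac_sub k i : (i <= 2 ^ k)%nat -> INR (2 ^ k - i) / INR (2 ^ k) = 1 - INR i / 2 ^ k.
Proof.
  intro H. rewrite minus_INR, INR_pow2 by exact H. field. apply Rgt_not_eq, pow2_pos.
Qed.

Lemma pow2_pos_nat k : (0 < 2 ^ k)%nat.
Proof. apply Nat.neq_0_lt_0, Nat.pow_nonzero; lia. Qed.

(** An upper bound on [V f n j] is a lower bound on the measure of the complementary event, which is
    Sigma11 as well. Both sides of the cut of [V f n j] thus become Sigma11, uniformly in [n] and
    [j]. *)
Lemma V_code f : DeltaMap f -> exists a b,
  (forall n j k i, MuGt (arg a (pair n j)) i (2 ^ k) <-> INR i / 2 ^ k < V f n j) /\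
  (forall n j k i, (i <= 2 ^ k)%nat ->
    (MuGt (arg b (pair n j)) (2 ^ k - i) (2 ^ k) <-> V f n j < INR i / 2 ^ k)).
Proof.
  intro Hf.
  destruct (DeltaMap_code f (fun v _ j => (v < j)%nat) Hf) as [a Ha]; [intros; sg|].
  destruct (DeltaMap_code f (fun v _ j => (j <= v)%nat) Hf) as [b Hb]; [intros; sg|].
  assert (EV : forall n j, mu (fun x => U (bn x) (arg a (pair n j))) = V f n j).
  { intros; apply mu_ext; intro x; symmetry; apply Ha. }
  exists a, b. split.
  - intros n j k i. rewrite (MuGt_spec _ _ _ (pow2_pos_nat k)), INR_pow2, EV. reflexivity.
  - intros n j k i Hi. rewrite (MuGt_spec _ _ _ (pow2_pos_nat k)), frac_sub by exact Hi.
    replace (mu (fun x => U (bn x) (arg b (pair n j)))) with (1 - V f n j); [lra|].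
    rewrite <- EV. pose proof (mu_U_measurable (arg a (pair n j))).
    pose proof (mu_compl (fun x => U (bn x) (arg a (pair n j)))).
    rewrite (mu_ext (fun x => U (bn x) (arg b (pair n j))) (fun x => ~ U (bn x) (arg a (pair n j)))); [lra|].
    intro x. rewrite <- Ha, <- Hb. lia.
Qed.

Lemma D_code f : DeltaMap f -> exists q, forall n j a b, (0 < b)%nat ->
  (MuGt (arg q (pair n j)) a b <-> INR a / INR b < D f n j).
Proof.
  intro Hf. destruct (DeltaMap_code f (fun v _ j => v = j) Hf) as [q Hq]; [intros; sg|].
  exists q. intros n j a b Hb. rewrite (MuGt_spec _ _ _ Hb).
  rewrite (mu_ext (fun x => U (bn x) (arg q (pair n j))) (fun x => vb (f x) n = j)); [reflexivity|].
  intro x; symmetry; apply Hq.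
Qed.

Lemma V_measurable f n j C : DeltaMap f ->
  mu (fun x => C x /\ (vb (f x) n < j)%nat) + mu (fun x => C x /\ ~ (vb (f x) n < j)%nat) <= mu C.
Proof.
  intro Hf. destruct (DeltaMap_code f (fun v _ j => (v < j)%nat) Hf) as [a Ha]; [intros; sg|].
  apply mu_caratheodory.
  rewrite (mu_ext _ (fun x => U (bn x) (arg a (pair n j)))) by (intro; apply Ha).
  rewrite (mu_ext (fun x => ~ _) (fun x => ~ U (bn x) (arg a (pair n j)))) by (intro; rewrite <- Ha; tauto).
  apply mu_U_measurable.
Qed.

Lemma D_measurable f n j C : DeltaMap f ->
  mu (fun x => C x /\ vb (f x) n = j) + mu (fun x => C x /\ ~ vb (f x) n = j) <= mu C.
Proof.
  intro Hf. destruct (DeltaMap_code f (fun v _ j => v = j) Hf) as [a Ha]; [intros; sg|].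
  apply mu_caratheodory.
  rewrite (mu_ext _ (fun x => U (bn x) (arg a (pair n j)))) by (intro; apply Ha).
  rewrite (mu_ext (fun x => ~ _) (fun x => ~ U (bn x) (arg a (pair n j)))) by (intro; rewrite <- Ha; tauto).
  apply mu_U_measurable.
Qed.

Lemma vb_lt_up x y n n' : (n <= n')%nat -> (vb x n < vb y n)%nat -> (vb x n' < vb y n')%nat.
Proof.
  intros H L. induction H as [|m H IH]; [exact L|].
  rewrite !vb_S. destruct (x m), (y m); lia.
Qed.

Lemma vb_lt_down x y n n' : (n <= n')%nat -> (vb x n' < vb y n')%nat -> (vb x n <= vb y n)%nat.
Proof.
  intros H L. apply Nat.nlt_ge; intro K. apply (vb_lt_up y x n n' H) in K. lia.
Qed.

Lemma V_le f n j j' : (j <= j')%nat -> V f n j <= V f n j'.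
Proof. intro H. apply mu_mono; intros; lia. Qed.

Lemma V_le_vl f y n : V f n (vb y n) <= vl f y.
Proof. apply mu_mono; eauto. Qed.

Lemma vl_le_V f y n : vl f y <= V f n (S (vb y n)).
Proof.
  apply mu_mono. intros x [n' H].
  destruct (Nat.le_ge_cases n n') as [L|L].
  - apply (vb_lt_down _ _ _ _ L) in H. lia.
  - apply (vb_lt_up _ _ _ _ L) in H. lia.
Qed.

Lemma lt_vl f y r : r < vl f y -> exists n, r < V f n (vb y n).
Proof.
  intro H. apply NNPP; intro N. apply Rlt_not_le in H. apply H.
  apply (mu_cont (fun n x => (vb (f x) n < vb y n)%nat)).
  - intros n x. apply vb_lt_up; lia.
  - intro n. apply Rnot_lt_le; intro; apply N; eauto.
Qed.

Lemma vl_ge0 f y : 0 <= vl f y.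
Proof. apply mu_ge0. Qed.

Lemma V_S f n j : V f n (S j) <= V f n j + D f n j.
Proof.
  eapply Rle_trans; [|apply mu_union]. apply mu_mono; intros; lia.
Qed.

Lemma dyadic_between x y : 0 <= x < y -> exists k i, x < INR i / 2 ^ k < y.
Proof.
  intros [Hx Hxy].
  destruct (pow_lt_1_zero (/ 2)) with (y := y - x) as [k Hk]; [rewrite Rabs_pos_eq; lra|lra|].
  specialize (Hk k (le_n k)).
  assert (P : 0 < (/ 2) ^ k) by (apply pow_lt; lra).
  rewrite Rabs_pos_eq, pow_inv in Hk by lra.
  pose proof (pow2_pos k) as B.
  pose proof (archimed (x * 2 ^ k)) as [A1 A2].
  assert (A3 : (0 <= up (x * 2 ^ k))%Z) by (apply le_IZR; nra).
  exists k, (Z.to_nat (up (x * 2 ^ k))).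
  rewrite INR_IZR_INZ, Z2Nat.id by exact A3.
  assert (B' : 1 < (y - x) * 2 ^ k).
  { apply Rmult_lt_reg_l with (/ 2 ^ k); [apply Rinv_0_lt_compat, B|]. field_simplify; lra. }
  split; apply Rmult_lt_reg_r with (2 ^ k); try exact B; unfold Rdiv;
    rewrite ?Rmult_assoc, ?Rinv_l by lra; lra.
Qed.

(** * Binary digits of the distribution function *)

(** Because of the strict inequality, [G] picks the expansion ending in ones when [vl f y] is a
    positive dyadic rational. *)
Definition above (f : real -> real) (y : real) (k i : nat) : Prop := INR i / 2 ^ k < vl f y.

Fixpoint Gv (f : real -> real) (y : real) (k : nat) : nat :=
  match k with O => 0 | S k => 2 * Gv f y k + ind (above f y (S k) (2 * Gv f y k + 1)) end.

Definition G (f : real -> real) (y : real) : real :=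
  fun k => if excluded_middle_informative (above f y (S k) (2 * Gv f y k + 1)) then true else false.

Lemma vb_G f y k : vb (G f y) k = Gv f y k.
Proof.
  induction k as [|k IH]; [reflexivity|]. rewrite vb_S, IH. cbn [Gv]. unfold G, ind.
  destruct excluded_middle_informative; reflexivity.
Qed.

Lemma G_true f y k : G f y k = true <-> above f y (S k) (2 * vb (G f y) k + 1).
Proof.
  rewrite vb_G. unfold G. destruct excluded_middle_informative; split; congruence || tauto.
Qed.

Lemma G_bounds f y k :
  INR (vb (G f y) k) / 2 ^ k <= vl f y <= INR (S (vb (G f y) k)) / 2 ^ k.
Proof.
  induction k as [|k [IH1 IH2]].
  - simpl. pose proof (vl_ge0 f y). pose proof (mu_le1 (fun x => exists n, (vb (f x) n < vb y n)%nat)).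
    unfold vl in *. lra.
  - pose proof (G_true f y k) as T. unfold above in T.
    pose proof (pow2_pos k) as B. rewrite vb_S.
    set (v := vb (G f y) k) in *.
    assert (E : forall z, z / 2 ^ k = (2 * z) / 2 ^ S k) by (intro; simpl; field; lra).
    assert (E2 : INR (2 * v + 1) = 2 * INR v + 1) by (rewrite plus_INR, mult_INR; simpl; ring).
    rewrite E in IH1, IH2. rewrite S_INR in *.
    destruct (G f y k).
    + destruct T as [T _]. specialize (T eq_refl). rewrite E2 in *.
      split; [lra|]. replace (2 * INR v + 1 + 1) with (2 * (INR v + 1)) by ring. exact IH2.
    + assert (K : vl f y <= INR (2 * v + 1) / 2 ^ S k) by (apply Rnot_lt_le; intro K; apply T in K; discriminate).
      rewrite E2 in K. rewrite Nat.add_0_r, mult_INR. split; [exact IH1|exact K].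
Qed.

(** [bn (G f y)] is the only solution of the condition [Q], so that an existential quantifier reads
    off its zeros as well as its ones. In [Q], digit 1 asserts that some [V f n (vb y n)] exceeds
    the midpoint; digit 0 asserts, positively, that all of them lie below every larger dyadic
    rational. *)
Lemma G_hyp_le f y : DeltaMap f -> hyp_le (G f y) y.
Proof.
  intro Hf. destruct (V_code f Hf) as (a & b & Ha & Hb).
  set (Q := fun (o F : nat -> nat) =>
    forall k, (F k = 1%nat /\ exists n, MuGt (arg a (pair n (val o n))) (2 * val F k + 1) (2 ^ S k)) \/
      (F k = 0%nat /\ forall n k' i', (i' <= 2 ^ k')%nat ->
         ((2 * val F k + 1) * 2 ^ k' < i' * 2 ^ S k)%nat ->
         MuGt (arg b (pair n (val o n))) (2 ^ k' - i') (2 ^ k'))).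
  assert (SQ : forall c, Sg (fun g => exists F : nat -> nat, Q (hdF g) F /\ F (hd g) = c)).
  { intro c. unfold Q. sg. }
  assert (E0 : forall k i, above f y k i <-> exists n, MuGt (arg a (pair n (val (bn y) n))) i (2 ^ k)).
  { intros k i. split.
    - intro H. apply lt_vl in H as [n Hn]. exists n. apply Ha, Hn.
    - intros [n Hn]. apply Ha in Hn. pose proof (V_le_vl f y n). unfold above, vb in *. lra. }
  assert (E1 : forall k i, ~ above f y k i <-> forall n k' i', (i' <= 2 ^ k')%nat ->
         (i * 2 ^ k' < i' * 2 ^ k)%nat -> MuGt (arg b (pair n (val (bn y) n))) (2 ^ k' - i') (2 ^ k')).
  { intros k i. split.
    - intros H n k' i' Hi L. apply Hb; [exact Hi|].
      apply (frac_lt i (2 ^ k) i' (2 ^ k')) in L; try apply pow2_pos_nat.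
      rewrite !INR_pow2 in L. pose proof (V_le_vl f y n). unfold above, vb in *. lra.
    - intros H K. apply lt_vl in K as [n Hn].
      assert (P : 0 <= INR i / 2 ^ k).
      { apply Rmult_le_pos; [apply pos_INR|left; apply Rinv_0_lt_compat, pow2_pos]. }
      destruct (dyadic_between _ _ (conj P Hn)) as (k' & i' & L1 & L2).
      (* Dyadic rationals up to 1 suffice since measures are at most 1; the bound makes the
         subtraction [2 ^ k' - i'] exact. *)
      assert (Hi : (i' <= 2 ^ k')%nat).
      { apply INR_le. rewrite INR_pow2.
        assert (L3 : INR i' / 2 ^ k' <= 1) by (eapply Rle_trans; [left; apply L2|apply mu_le1]).
        pose proof (pow2_pos k') as B. apply Rmult_le_compat_r with (r := 2 ^ k') in L3; [|lra].
        unfold Rdiv in L3. rewrite Rmult_assoc, Rinv_l in L3 by lra. lra. }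
      specialize (H n k' i' Hi). rewrite (Hb n _ k' i' Hi) in H.
      apply (Rlt_asym _ _ L2), H. apply (frac_lt i (2 ^ k) i' (2 ^ k')); try apply pow2_pos_nat.
      rewrite !INR_pow2. exact L1. }
  assert (QG : Q (bn y) (bn (G f y))).
  { intro k. change (val (bn (G f y)) k) with (vb (G f y) k). unfold bn at 1 3.
    destruct (G f y k) eqn:E; [left|right]; split; try reflexivity.
    - apply E0, G_true, E.
    - apply (E1 (S k)). rewrite <- G_true. congruence. }
  assert (QU : forall F, Q (bn y) F -> F = bn (G f y)).
  { intros F HF.
    assert (S : forall k, val F k = vb (G f y) k -> F k = bn (G f y) k).
    { intros k Hk. unfold bn at 1. destruct (HF k) as [[-> K]|[-> K]]; rewrite Hk in K.
      - apply E0 in K. apply G_true in K. rewrite K; reflexivity.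
      - apply (E1 (S k)) in K. rewrite <- G_true in K. destruct (G f y k); [tauto|reflexivity]. }
    assert (T : forall k, val F k = vb (G f y) k).
    { induction k as [|k IH]; [reflexivity|]. unfold vb in *. simpl. rewrite IH.
      rewrite (S k) by exact IH. reflexivity. }
    apply functional_extensionality; intro k; apply S, T. }
  assert (QE : forall c n, (exists F : nat -> nat, Q (bn y) F /\ F n = c) <-> bn (G f y) n = c).
  { intros c n; split; [intros (F & HF & <-); rewrite (QU F HF); reflexivity|eauto]. }
  split.
  - destruct (sg_Sigma11 _ y (SQ 1%nat)) as [phi Hphi]. exists phi. intro n. rewrite <- Hphi.
    unfold at_, hdF, hd; simpl. rewrite QE. unfold bn; destruct (G f y n); split; congruence.
  - destruct (sg_Sigma11 _ y (SQ 0%nat)) as [phi Hphi]. exists phi. intro n. rewrite <- Hphi.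
    unfold at_, hdF, hd; simpl. rewrite QE. unfold bn; destruct (G f y n); split; congruence.
Qed.

(** Strictness lets [vl f y] determine every cylinder around [y]. If it fails, [vl f y] is one of
    the countably many numbers [V f n j]. *)
Definition regular (f : real -> real) (y : real) : Prop :=
  forall n, V f n (vb y n) < vl f y < V f n (S (vb y n)).

Lemma G_hyp_ge f y : DeltaMap f -> regular f y -> hyp_le y (G f y).
Proof.
  intros Hf Hreg. destruct (V_code f Hf) as (a & b & Ha & Hb).
  (* [2 * j + c] is a guess for [vb y (S n)] with last bit [c]; the first [k] digits of [G f y] must
     place [vl f y] strictly between the values of [V] at the two ends of that cylinder. *)
  set (Q := fun (o : nat -> nat) c n => exists j k,
    MuGt (arg b (pair (S n) (2 * j + c))) (2 ^ k - val o k) (2 ^ k) /\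
    MuGt (arg a (pair (S n) (S (2 * j + c)))) (S (val o k)) (2 ^ k)).
  assert (SQ : forall c, Sg (fun g => Q (hdF g) c (hd g))) by (intro c; unfold Q; sg).
  assert (QE : forall (c : bool) n, Q (bn (G f y)) (if c then 1%nat else 0%nat) n <-> y n = c).
  { intros c n. split.
    - intros (j & k & H1 & H2). change (val (bn (G f y)) k) with (vb (G f y) k) in *.
      apply Hb in H1; [|apply Nat.lt_le_incl, val_lt]. apply Ha in H2.
      pose proof (G_bounds f y k) as [B1 B2].
      set (J := (2 * j + if c then 1 else 0)%nat) in *.
      assert (EJ : J = vb y (S n)).
      { destruct (Nat.lt_trichotomy J (vb y (S n))) as [L|[L|L]]; [|exact L|].
        - pose proof (V_le f (S n) (S J) (vb y (S n)) L). pose proof (V_le_vl f y (S n)). lra.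
        - pose proof (V_le f (S n) (S (vb y (S n))) J L). pose proof (vl_le_V f y (S n)). lra. }
      rewrite vb_S in EJ. unfold J in EJ. destruct c, (y n); try reflexivity; lia.
    - intros <-. destruct (Hreg (S n)) as [L1 L2]. rewrite vb_S in L1, L2.
      set (J := (2 * vb y n + if y n then 1 else 0)%nat) in *.
      destruct (pow_lt_1_zero (/ 2)) with (y := Rmin (vl f y - V f (S n) J) (V f (S n) (S J) - vl f y))
        as [k Hk]; [rewrite Rabs_pos_eq; lra|apply Rmin_pos; lra|].
      specialize (Hk k (le_n k)).
      assert (P : 0 < (/ 2) ^ k) by (apply pow_lt; lra).
      rewrite Rabs_pos_eq, pow_inv in Hk by lra.
      assert (Hk1 : / 2 ^ k < vl f y - V f (S n) J) by (eapply Rlt_le_trans; [exact Hk|apply Rmin_l]).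
      assert (Hk2 : / 2 ^ k < V f (S n) (S J) - vl f y) by (eapply Rlt_le_trans; [exact Hk|apply Rmin_r]).
      pose proof (G_bounds f y k) as [B1 B2].
      assert (B3 : INR (S (vb (G f y) k)) / 2 ^ k = INR (vb (G f y) k) / 2 ^ k + / 2 ^ k).
      { rewrite S_INR. field. apply Rgt_not_eq, pow2_pos. }
      exists (vb y n), k. change (val (bn (G f y)) k) with (vb (G f y) k). fold J. split.
      + apply Hb; [apply Nat.lt_le_incl, val_lt|]. lra.
      + apply Ha. lra. }
  split.
  - destruct (sg_Sigma11 _ (G f y) (SQ 1%nat)) as [phi Hphi]. exists phi. intro n. rewrite <- Hphi.
    unfold at_, hdF, hd; simpl. rewrite (QE true). reflexivity.
  - destruct (sg_Sigma11 _ (G f y) (SQ 0%nat)) as [phi Hphi]. exists phi. intro n. rewrite <- Hphi.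
    unfold at_, hdF, hd; simpl. rewrite (QE false). destruct (y n); split; congruence.
Qed.

(** * Atoms *)

Definition nonatom (f : real -> real) (y : real) : Prop :=
  forall e, 0 < e -> exists n, D f n (vb y n) < e.

Lemma atom_hyperarithmetic f y : DeltaMap f -> ~ nonatom f y -> hyperarithmetic y.
Proof.
  intros Hf Hat.
  assert (He : exists e, 0 < e /\ forall n, e <= D f n (vb y n)).
  { apply NNPP; intro N. apply Hat. intros e He. apply NNPP; intro K. apply N.
    exists e; split; [exact He|]. intro n. apply Rnot_lt_le; intro; apply K; eauto. }
  destruct He as (e & He & He').
  destruct (completeness (fun r => forall n, r <= D f n (vb y n))) as [L [L1 L2]].
  { exists (D f 0 (vb y 0)). intros r Hr; apply Hr. }
  { exists e; exact He'. }
  assert (HL : e <= L) by (apply L1; exact He').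
  assert (HD : forall n, L <= D f n (vb y n)) by (intro n; apply L2; intros r Hr; apply Hr).
  (* [L] is the mass of the atom. Inside a cylinder of mass below [2 * (a / b)], two strings of the
     same length cannot both have mass above [a / b]; so [y] is the only path along which the mass
     stays above it. *)
  destruct (rational_between (L / 2) L) as (a & b & Hb & R1 & R2); [lra|].
  assert (HN : exists N, D f N (vb y N) < 2 * (INR a / INR b)).
  { apply NNPP; intro K. assert (2 * (INR a / INR b) <= L); [|lra].
    apply L1. intro n. apply Rnot_lt_le; intro; apply K; eauto. }
  destruct HN as [N HN]. destruct (D_code f Hf) as [q Hq].
  set (Q := fun F => val F N = vb y N /\
    forall n, (N <= n)%nat -> MuGt (arg q (pair n (val F n))) a b).
  assert (Qy : Q (bn y)).
  { split; [reflexivity|]. intros n _. apply Hq; [exact Hb|]. specialize (HD n). unfold vb in HD. lra. }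
  assert (QU : forall F, Q F -> forall n, val F n = vb y n).
  { intros F [H1 H2] n. apply NNPP; intro Hne.
    set (m := Nat.max N n).
    assert (Hm : val F m <> vb y m).
    { intro K. apply Hne. apply val_ext. intros i Hi. apply (val_inj _ _ m K). lia. }
    specialize (H2 m ltac:(lia)). apply Hq in H2; [|exact Hb].
    pose proof (D_measurable f m (vb y m) (fun x => vb (f x) N = vb y N) Hf) as C.
    assert (C1 : D f m (vb y m) <= mu (fun x => vb (f x) N = vb y N /\ vb (f x) m = vb y m)).
    { apply mu_mono. intros x Hx. split; [|exact Hx].
      apply val_ext. intros i Hi. apply (val_inj _ _ m Hx). lia. }
    assert (C2 : D f m (val F m) <= mu (fun x => vb (f x) N = vb y N /\ ~ vb (f x) m = vb y m)).
    { apply mu_mono. intros x Hx. split; [|congruence]. rewrite <- H1.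
      apply val_ext. intros i Hi. apply (val_inj _ _ m Hx). lia. }
    specialize (HD m). unfold D in *. lra. }
  assert (SQ : forall P : nat -> Prop, (forall t, Fn t -> Sg (fun g => P (t g))) ->
    Sg (fun g => exists F : nat -> nat, Q F /\ P (F (hd g)))).
  { intros P HP. unfold Q. apply sg_exF, sg_and; [sg|apply HP; sg]. }
  (* Solutions of [Q] are fixed only up to [sgn], so the bits are read through it. *)
  assert (QE : forall F n, Q F -> sgn (F n) = bn y n).
  { intros F n HF. pose proof (QU F HF (S n)) as E. rewrite (val_inj _ _ _ E n) by lia.
    unfold bn; destruct (y n); reflexivity. }
  split.
  - destruct (sg_Sigma11 _ (fun _ => false) (SQ (fun v => sgn v = 1%nat) ltac:(intros; sg))) as [phi Hphi].
    exists phi. intro n. rewrite <- Hphi. split.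
    + intro Hn. exists (bn y). split; [exact Qy|]. rewrite (QE _ _ Qy). unfold hd, bn; simpl. rewrite Hn; reflexivity.
    + intros (F & HF & H). rewrite (QE _ _ HF) in H. unfold hd, bn in H; simpl in H. destruct (y n); congruence.
  - destruct (sg_Sigma11 _ (fun _ => false) (SQ (fun v => sgn v = 0%nat) ltac:(intros; sg))) as [phi Hphi].
    exists phi. intro n. rewrite <- Hphi. split.
    + intro Hn. exists (bn y). split; [exact Qy|]. rewrite (QE _ _ Qy). unfold hd, bn; simpl. destruct (y n); congruence.
    + intros (F & HF & H). rewrite (QE _ _ HF) in H. unfold hd, bn in H; simpl in H. destruct (y n); congruence.
Qed.

(** * Nullity transfers along the distribution function *)

Lemma nat_min_max M (P : nat -> Prop) :
  (exists j, (j < M)%nat /\ P j) ->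
  exists j0 j1, P j0 /\ P j1 /\ forall j, (j < M)%nat -> P j -> (j0 <= j <= j1)%nat.
Proof.
  induction M as [|M IH]; intros (j & Hj & HP); [lia|].
  destruct (classic (exists j, (j < M)%nat /\ P j)) as [H|H].
  - destruct (IH H) as (j0 & j1 & H0 & H1 & Hb).
    destruct (classic (P M)) as [HM|HM].
    + exists j0, M. split; [exact H0|split; [exact HM|]]. intros i Hi HPi.
      destruct (Nat.eq_dec i M) as [->|].
      * destruct H as (l & Hl & HPl). specialize (Hb l Hl HPl).
        split; [|lia]. lia.
      * specialize (Hb i ltac:(lia) HPi). lia.
    + exists j0, j1. split; [exact H0|split; [exact H1|]]. intros i Hi HPi.
      destruct (Nat.eq_dec i M) as [->|]; [contradiction|]. apply Hb; [lia|exact HPi].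
  - exists j, j. split; [exact HP|split; [exact HP|]]. intros i Hi HPi.
    destruct (Nat.eq_dec i M) as [->|]; [|exfalso; apply H; exists i; split; [lia|exact HPi]].
    destruct (Nat.eq_dec j M) as [->|]; [lia|exfalso; apply H; exists j; split; [lia|exact HP]].
Qed.

(** At each level the cylinders whose [V]-interval lies between [a - d] and [b + d] are enclosed by
    two extreme ones, [j0] and [j1], so their total mass is at most [b - a + 2 * d]. Without an atom
    at [f x], both ends of the [V]-interval around [f x] approach [vl f (f x)], and [x] is caught at
    some level. *)
Lemma mu_vl_interval f a b : DeltaMap f -> a <= b ->
  mu (fun x => nonatom f (f x) /\ a <= vl f (f x) <= b) <= b - a.
Proof.
  intros Hf Hab. apply Rnot_lt_le; intro L.
  set (d := (mu (fun x => nonatom f (f x) /\ a <= vl f (f x) <= b) - (b - a)) / 3).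
  assert (Hd : 0 < d) by (unfold d; lra).
  set (X := fun n x => a - d <= V f n (vb (f x) n) /\ V f n (S (vb (f x) n)) <= b + d).
  assert (HX : forall n x, X n x -> X (S n) x).
  { intros n x [H1 H2]. split.
    - eapply Rle_trans; [exact H1|]. apply mu_mono. intros z. apply vb_lt_up; lia.
    - eapply Rle_trans; [|exact H2]. apply mu_mono. intros z Hz.
      apply Nat.lt_succ_r. apply Nat.nlt_ge; intro K. apply (vb_lt_up _ _ n (S n)) in K; lia. }
  assert (E : mu (fun x => exists n, X n x) <= b - a + 2 * d).
  { apply mu_cont; [exact HX|]. intro n.
    destruct (classic (exists j, (j < 2 ^ n)%nat /\ a - d <= V f n j /\ V f n (S j) <= b + d)) as [H|H].
    - destruct (nat_min_max _ _ H) as (j0 & j1 & [H0 _] & [_ H1] & Hb).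
      assert (Hj : (j0 <= j1)%nat) by (destruct H as (j & Hj & HPj); specialize (Hb j Hj HPj); lia).
      pose proof (V_measurable f n j0 (fun x => (vb (f x) n < S j1)%nat) Hf) as C.
      assert (C1 : mu (X n) <= mu (fun x => (vb (f x) n < S j1)%nat /\ ~ (vb (f x) n < j0)%nat)).
      { apply mu_mono. intros x Hx. specialize (Hb _ (val_lt (bn (f x)) n) Hx). unfold vb in *. lia. }
      assert (C2 : mu (fun x => (vb (f x) n < j0)%nat) <=
        mu (fun x => (vb (f x) n < S j1)%nat /\ (vb (f x) n < j0)%nat)).
      { apply mu_mono. intros x Hx. lia. }
      unfold V in *. lra.
    - apply Rle_trans with 0; [|lra]. apply (mu_null_subset _ (fun _ => False)).
      + intros x Hx. apply H. exists (vb (f x) n). split; [apply val_lt|exact Hx].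
      + apply mu_false. }
  assert (mu (fun x => nonatom f (f x) /\ a <= vl f (f x) <= b) <= mu (fun x => exists n, X n x));
    [|unfold d in *; lra].
  apply mu_mono. intros x (Hna & Ha & Hb).
  destruct (lt_vl f (f x) (a - d)) as [n1 H1]; [lra|].
  destruct (Hna d Hd) as [n2 H2].
  assert (M : forall n n', (n <= n')%nat -> V f n (vb (f x) n) <= V f n' (vb (f x) n')).
  { intros n n' H. apply mu_mono. intros z. apply vb_lt_up, H. }
  assert (M' : forall n n', (n <= n')%nat -> V f n' (S (vb (f x) n')) <= V f n (S (vb (f x) n))).
  { intros n n' H. apply mu_mono. intros z Hz.
    apply Nat.lt_succ_r. apply Nat.nlt_ge; intro K. apply (vb_lt_up _ _ n n' H) in K; lia. }
  exists (Nat.max n1 n2). split.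
  - specialize (M n1 (Nat.max n1 n2) ltac:(lia)). lra.
  - specialize (M' n2 (Nat.max n1 n2) ltac:(lia)).
    pose proof (V_S f n2 (vb (f x) n2)). pose proof (V_le_vl f (f x) n2). lra.
Qed.

Lemma extends_vb x s : extends x s -> vb x (length s) = vb (fun i => nth i s false) (length s).
Proof. intro H. apply val_ext. intros i Hi. unfold bn. rewrite H by exact Hi. reflexivity. Qed.

Lemma mu_preimage f A : DeltaMap f -> null A ->
  (forall x y, A x -> hyp_equiv x y -> A y) -> (forall y, A y -> ~ hyperarithmetic y) ->
  mu (fun x => A (f x)) <= 0.
Proof.
  intros Hf Hnull Hclosed Hnonhyp.
  (* A failure of regularity fixes [vl f (f x)] to some [V f n j]; the equation is stated as a
     degenerate interval to fit [mu_vl_interval]. *)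
  set (Irr := fun p x => nonatom f (f x) /\ V f (p1 p) (p2 p) <= vl f (f x) <= V f (p1 p) (p2 p)).
  set (Reg := fun x => nonatom f (f x) /\ A (G f (f x))).
  assert (HIrr : mu (fun x => exists p, Irr p x) <= 0).
  { apply mu_null_union. intro p. eapply Rle_trans; [apply mu_vl_interval; [exact Hf|lra]|lra]. }
  assert (HReg : mu Reg <= 0).
  { apply Rnot_lt_le; intro L.
    destruct (Hnull (mu Reg / 2)) as (c & Hc & HA); [lra|].
    assert (mu (fun x => exists k, nonatom f (f x) /\ extends (G f (f x)) (c k)) <= mu Reg / 2).
    { apply (mu_sigma _ (fun k => (/ 2) ^ length (c k))); [|exact Hc].
      (* [G_bounds] turns the cylinder of [c k] into a closed interval of length [(/ 2) ^ l] for
         [vl], so the cover of [A] keeps its weight when pulled back. *)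
      intro k. set (l := length (c k)). set (i := vb (fun i => nth i (c k) false) l).
      assert (HB : INR (S i) / 2 ^ l = INR i / 2 ^ l + / 2 ^ l).
      { rewrite S_INR. field. apply Rgt_not_eq, pow2_pos. }
      pose proof (Rinv_0_lt_compat _ (pow2_pos l)).
      eapply Rle_trans; [|eapply Rle_trans; [apply (mu_vl_interval f (INR i / 2 ^ l) (INR (S i) / 2 ^ l) Hf)|]].
      - apply mu_mono. intros x [H1 H2]. split; [exact H1|].
        apply extends_vb in H2. fold l in H2. unfold i. rewrite <- H2. apply G_bounds.
      - lra.
      - rewrite pow_inv. lra. }
    assert (mu Reg <= mu (fun x => exists k, nonatom f (f x) /\ extends (G f (f x)) (c k))); [|lra].
    apply mu_mono. intros x [H1 H2]. destruct (HA _ H2) as [k Hk]. eauto. }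
  apply (mu_null_subset _ (fun x => (exists p, Irr p x) \/ Reg x)).
  2: { eapply Rle_trans; [apply mu_union|lra]. }
  intros x Hx.
  assert (Hna : nonatom f (f x)).
  { apply NNPP; intro N. apply (Hnonhyp _ Hx), (atom_hyperarithmetic f _ Hf N). }
  destruct (classic (regular f (f x))) as [Hr|Hr].
  - right. split; [exact Hna|]. apply (Hclosed (f x)); [exact Hx|].
    split; [apply G_hyp_ge|apply G_hyp_le]; assumption.
  - left. apply not_all_ex_not in Hr as [n Hn].
    pose proof (V_le_vl f (f x) n). pose proof (vl_le_V f (f x) n).
    destruct (Req_dec (V f n (vb (f x) n)) (vl f (f x))) as [E|E].
    + exists (pair n (vb (f x) n)). unfold Irr. rewrite p1_pair, p2_pair. split; [exact Hna|lra].
    + exists (pair n (S (vb (f x) n))). unfold Irr. rewrite p1_pair, p2_pair. split; [exact Hna|].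
      assert (~ vl f (f x) < V f n (S (vb (f x) n))) by (intro; apply Hn; lra). lra.
Qed.

(** * Outer measure zero implies [null] *)

Fixpoint str (k t : nat) : list bool :=
  match k with O => nil | S k => str k (t / 2) ++ Nat.odd t :: nil end.

Lemma length_str k : forall t, length (str k t) = k.
Proof. induction k; intro t; simpl; [reflexivity|]. rewrite length_app, IHk; simpl; lia. Qed.

Lemma vb_half x k : (vb x (S k) / 2)%nat = vb x k.
Proof.
  rewrite vb_S. symmetry. apply Nat.div_unique with (if x k then 1 else 0)%nat.
  - destruct (x k); lia.
  - reflexivity.
Qed.

Lemma extends_str x k : extends x (str k (vb x k)).
Proof.
  induction k as [|k IH]; intros i Hi; [simpl in Hi; lia|].
  change (str (S k) (vb x (S k))) with (str k (vb x (S k) / 2) ++ Nat.odd (vb x (S k)) :: nil) in *.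
  rewrite length_app, length_str in Hi; simpl in Hi. rewrite vb_half.
  destruct (Nat.eq_dec i k) as [->|].
  - rewrite app_nth2; rewrite length_str; [|lia]. rewrite Nat.sub_diag. simpl.
    rewrite vb_S, Nat.add_comm, Nat.odd_add_mul_2.
    destruct (x k); reflexivity.
  - rewrite app_nth1; [apply IH|]; rewrite length_str; lia.
Qed.

(** Unlike [sum_f_R0], this allows empty sums, so that ranges split without a shift ([ssum_add]). *)
Fixpoint ssum (a : nat -> R) (N : nat) : R :=
  match N with O => 0 | S n => ssum a n + a n end.

Lemma ssum_sum a N : sum_f_R0 a N = ssum a (S N).
Proof. induction N as [|n IH]; simpl in *; [lra|]. rewrite IH; reflexivity. Qed.

Lemma ssum_add a M N : ssum a (M + N) = ssum a M + ssum (fun i => a (M + i)%nat) N.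
Proof.
  induction N as [|n IH]; simpl; [rewrite Nat.add_0_r; lra|].
  rewrite <- plus_n_Sm. simpl. rewrite IH. lra.
Qed.

Lemma ssum_le a b N : (forall i, (i < N)%nat -> a i <= b i) -> ssum a N <= ssum b N.
Proof.
  induction N as [|n IH]; intro H; simpl; [lra|].
  apply Rplus_le_compat; [apply IH; intros; apply H; lia|apply H; lia].
Qed.

Lemma ssum_plus a b N : ssum (fun i => a i + b i) N = ssum a N + ssum b N.
Proof. induction N as [|n IH]; simpl; [lra|]. rewrite IH; lra. Qed.

Lemma ssum_ind (P : nat -> Prop) c N : ssum (fun i => INR (ind (P i)) * c) N = INR (cnt N P) * c.
Proof. induction N as [|n IH]; simpl; [lra|]. rewrite IH, plus_INR. lra. Qed.

Lemma ssum_geom L N : ssum (fun i => (/ 2) ^ (i + L)) N <= 2 * (/ 2) ^ L.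
Proof.
  assert (H : ssum (fun i => (/ 2) ^ (i + L)) N = 2 * (/ 2) ^ L - 2 * (/ 2) ^ (N + L)).
  { induction N as [|n IH]; simpl; [lra|]. rewrite IH. field. }
  assert (0 < (/ 2) ^ (N + L)) by (apply pow_lt; lra). lra.
Qed.

(** The minimal strings have disjoint cylinders with the same union as [u], so the weights of those
    up to level [k] add up to at most [lv u k]. *)
Definition Minimal (u : nat -> nat -> Prop) (k t : nat) : Prop :=
  u k t /\ match k with O => True | S k => ~ u k (t / 2)%nat end.

Lemma cnt_Minimal u k : mono u ->
  (cnt (2 ^ S k) (Minimal u (S k)) + 2 * cnt (2 ^ k) (u k) <= cnt (2 ^ S k) (u (S k)))%nat.
Proof.
  intro Hu.
  assert (E : cnt (2 ^ S k) (fun t => u k (t / 2)%nat) = (2 * cnt (2 ^ k) (u k))%nat).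
  { change (2 ^ S k)%nat with (2 * 2 ^ k)%nat. rewrite cnt_split.
    assert (E0 : forall t, (2 * t / 2)%nat = t) by (intro; symmetry; apply Nat.div_unique with 0%nat; lia).
    assert (E1 : forall t, ((2 * t + 1) / 2)%nat = t) by (intro; symmetry; apply Nat.div_unique with 1%nat; lia).
    rewrite (cnt_ext _ (fun t => u k (2 * t / 2)%nat) (u k)) by (intros; rewrite E0; tauto).
    rewrite (cnt_ext _ (fun t => u k ((2 * t + 1) / 2)%nat) (u k)) by (intros; rewrite E1; tauto).
    lia. }
  rewrite <- E, <- cnt_modular.
  rewrite (cnt_none _ (fun t => _ /\ _)) by (intros t _ [[_ H] H']; contradiction).
  rewrite Nat.add_0_r. apply cnt_le. intros t _ [[H _]|H]; [exact H|].
  apply Hu in H as [H0 H1]. pose proof (Nat.div_mod_eq t 2) as Et.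
  pose proof (Nat.mod_upper_bound t 2 ltac:(lia)).
  destruct (t mod 2) as [|[|]]; [| |lia]; rewrite Et; [rewrite Nat.add_0_r|]; assumption.
Qed.

(** String number [i] is the binary notation of [S i] without its leading 1; level [k] starts at
    [2 ^ k - 1]. *)
Definition level (i : nat) : nat := Nat.log2 (S i).
Definition index (i : nat) : nat := S i - 2 ^ level i.

Lemma level_index k t : (t < 2 ^ k)%nat ->
  level (2 ^ k - 1 + t) = k /\ index (2 ^ k - 1 + t) = t.
Proof.
  intro H. pose proof (pow2_pos_nat k).
  assert (E : level (2 ^ k - 1 + t) = k).
  { unfold level. apply Nat.log2_unique; simpl; lia. }
  unfold index. rewrite E. lia.
Qed.

Definition weight (u : nat -> nat -> Prop) (i : nat) : R :=
  INR (ind (Minimal u (level i) (index i))) * (/ 2) ^ level i.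

Lemma weight_ge0 u i : 0 <= weight u i.
Proof. apply Rmult_le_pos; [apply pos_INR|apply pow_le; lra]. Qed.

Lemma ssum_weight u k : mono u -> ssum (weight u) (2 ^ S k - 1) <= lv u k.
Proof.
  intro Hu.
  assert (E : forall k, ssum (fun i => weight u (2 ^ k - 1 + i)) (2 ^ k) =
    INR (cnt (2 ^ k) (Minimal u k)) * (/ 2) ^ k).
  { intro j. rewrite <- ssum_ind. apply Rle_antisym; apply ssum_le; intros i Hi;
      unfold weight; destruct (level_index j i Hi) as [-> ->]; lra. }
  induction k as [|k IH].
  - pose proof (E 0%nat) as E0. simpl in E0 |- *. rewrite E0. unfold lv. simpl.
    unfold Minimal, ind. repeat destruct excluded_middle_informative; simpl; try tauto; lra.
  - replace (2 ^ S (S k) - 1)%nat with (2 ^ S k - 1 + 2 ^ S k)%nat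
      by (pose proof (pow2_pos_nat k); simpl; lia).
    rewrite ssum_add, E.
    pose proof (cnt_Minimal u k Hu) as C. apply le_INR in C. rewrite plus_INR, mult_INR in C.
    simpl (INR 2) in C. unfold lv in *.
    pose proof (pow2_pos k). rewrite pow_inv. simpl (2 ^ S k) in *.
    eapply Rle_trans; [apply Rplus_le_compat_r, IH|].
    apply Rmult_le_reg_r with (2 * 2 ^ k); [lra|]. field_simplify; lra.
Qed.

Lemma null_mu A : mu A <= 0 -> null A.
Proof.
  intros HA eps He.
  destruct (mu_cov A (eps / 2)) as (u & Mu & Cu & Hu); [lra|].
  destruct (pow_lt_1_zero (/ 2)) with (y := eps / 4) as [L HL]; [rewrite Rabs_pos_eq; lra|lra|].
  specialize (HL L (le_n L)).
  assert (P : 0 < (/ 2) ^ L) by (apply pow_lt; lra). rewrite Rabs_pos_eq in HL by lra.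
  exists (fun i => if excluded_middle_informative (Minimal u (level i) (index i))
    then str (level i) (index i) else repeat false (i + L)).
  split.
  - intro N. rewrite ssum_sum.
    apply Rle_trans with (ssum (fun i => weight u i + (/ 2) ^ (i + L)) (S N)).
    + apply ssum_le. intros i _. unfold weight, ind.
      assert (0 < (/ 2) ^ (i + L)) by (apply pow_lt; lra).
      destruct excluded_middle_informative; simpl INR;
        [rewrite length_str|rewrite repeat_length]; lra.
    + rewrite ssum_plus. pose proof (ssum_geom L (S N)).
      pose proof (ssum_weight u (S N) Mu) as B. specialize (Hu (S N)).
      assert (ssum (weight u) (S N) <= ssum (weight u) (2 ^ S (S N) - 1)); [|lra].
      assert (Hlt : (S N < 2 ^ S N)%nat) by (apply Nat.pow_gt_lin_r; lia).
      replace (2 ^ S (S N) - 1)%nat with (S N + (2 ^ S (S N) - 1 - S N))%nat by (simpl in *; lia).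
      rewrite ssum_add.
      assert (G0 : forall M, 0 <= ssum (fun i => weight u (S N + i)) M).
      { induction M as [|M IH]; cbn [ssum]; [lra|]. pose proof (weight_ge0 u (S N + M)). lra. }
      specialize (G0 (2 ^ S (S N) - 1 - S N)%nat). lra.
  - intros x Hx. destruct (Cu x Hx) as [k Hk].
    assert (HM : exists k, Minimal u k (vb x k)).
    { induction k as [|k IH]; [exists 0%nat; split; auto|].
      destruct (classic (u k (vb x k))) as [H|H]; [apply IH, H|].
      exists (S k); split; [exact Hk|]. rewrite vb_half. exact H. }
    clear k Hk. destruct HM as [k Hk]. exists (2 ^ k - 1 + vb x k)%nat.
    destruct (level_index k (vb x k) (val_lt _ k)) as [-> ->].
    destruct excluded_middle_informative; [apply extends_str|contradiction].
Qed.

(** * The countable family of Delta11 maps and the conclusion *)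

Definition LEmap (q m : nat) (x : real) : real :=
  fun n => if excluded_middle_informative (LE (bn x) (arg q n) zo (arg m m)) then true else false.

Lemma DeltaMap_LEmap q m : W m -> DeltaMap (LEmap q m).
Proof.
  intro HW.
  destruct (sg_U (fun g => LE (hdF g) (arg q (hd g)) zo (arg m m))) as [q1 H1]; [sg|].
  destruct (sg_U (fun g => LT zo (arg m m) (hdF g) (arg q (hd g)))) as [q0 H0]; [sg|].
  exists q1, q0. intros x n. rewrite <- H1, <- H0.
  unfold at_, hdF, hd; simpl. rewrite <- (not_LE _ _ _ _ HW). unfold LEmap.
  destruct excluded_middle_informative; split; split; congruence || tauto.
Qed.

Theorem mainTheorem12 (A : real -> Prop) :
  null A ->
  (forall x y, A x -> hyp_equiv x y -> A y) ->
  (forall y, A y -> ~ hyperarithmetic y) ->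
  null (upward_h A).
Proof.
  intros Hnull Hclosed Hnonhyp. apply null_mu.
  apply (mu_null_subset _ (fun x => (exists q, forall n, W n <-> U (bn x) (arg q n)) \/
    exists p, W (p2 p) /\ A (LEmap (p1 p) (p2 p) x))).
  - intros x (y & Ay & Hy).
    destruct (classic (exists q, forall n, W n <-> U (bn x) (arg q n))) as [H|H]; [auto|right].
    destruct (hyp_le_LE x y H Hy) as (q & m & HW & E).
    exists (pair q m). rewrite p1_pair, p2_pair. split; [exact HW|].
    replace (LEmap q m x) with y; [exact Ay|].
    apply functional_extensionality; intro n. specialize (E n). unfold LEmap.
    destruct excluded_middle_informative; destruct (y n); intuition congruence.
  - eapply Rle_trans; [apply mu_union|].
    assert (mu (fun x => exists p, W (p2 p) /\ A (LEmap (p1 p) (p2 p) x)) <= 0).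
    { apply mu_null_union. intro p. destruct (classic (W (p2 p))) as [HW|HW].
      - apply (mu_null_subset _ (fun x => A (LEmap (p1 p) (p2 p) x))); [tauto|].
        apply mu_preimage; try assumption. apply DeltaMap_LEmap, HW.
      - apply (mu_null_subset _ (fun _ => False)); [tauto|exact mu_false]. }
    pose proof mu_Sigma11_W. lra.
Qed.
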